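(* Let $\mathcal M$ be a 4-dimensional manifold with a II-generic metric $g$. Let $\mathcal N$ be a field of selfdual totally null 2-planes on $\mathcal M$. Then any two of the following imply the third: (0) The Cotton tensor of $g$ is degenerate on $\mathcal N$, $A_{|\mathcal N}\equiv 0$. (i) $\mathcal N$ is integrable, $[\mathcal N,\mathcal N]\subset\mathcal N$. (ii) The selfdual part of the Weyl tensor is algebraically special on $\mathcal M$ with $\mathcal N$ being a multiple principal field of selfdual totally null 2-planes.
   Context: $g$ is a complex-valued metric (a nondegenerate symmetric complex bilinear form on ${\rm T}^{\mathbb C}\mathcal M$; real metrics of any signature are included by complex bilinear extension). A field of totally null 2-planes is a complex rank-2 subbundle $\mathcal N\subset{\rm T}^{\mathbb C}\mathcal M$ with $g_{|\mathcal N}\equiv0$; given an orientation, it is selfdual or antiselfdual according to whether the Hodge star (normalized to square to the identity on bivectors) acts on $n_1\wedge n_2$, $n_1,n_2\in\mathcal N$, as $+1$ or $-1$. Curvature: $R(e_c,e_d)e_b=R^a{}_{bcd}e_a$, $R_{ab}=R^c{}_{acb}$, $R=g^{ab}R_{ab}$, Schouten tensor $\mathsf P_{ab}=\tfrac12R_{ab}-\tfrac1{12}Rg_{ab}$, Weyl tensor $C_{abcd}=R_{abcd}+g_{ad}\mathsf P_{cb}-g_{ac}\mathsf P_{db}+g_{bc}\mathsf P_{da}-g_{bd}\mathsf P_{ca}$, Cotton tensor $A_{abc}=\nabla_b\mathsf P_{ca}-\nabla_c\mathsf P_{ba}$. $A_{|\mathcal N}\equiv 0$ means $A(Z_1,Z_2,Z_3)=0$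 for all $Z_1,Z_2,Z_3\in\mathcal N$. A null frame is a local frame $(m,p,n,k)$ of ${\rm T}^{\mathbb C}\mathcal M$ with $g(m,p)=g(n,k)=1$, all other products of frame vectors zero; take it such that ${\rm Span}_{\mathbb C}(m,k)$ is selfdual. The selfdual part of the Weyl tensor has components $\Psi_0=C(m,k,m,k)$, $\Psi_1=C(m,k,n,k)$, $\Psi_2=C(m,k,p,n)$, $\Psi_3=C(p,n,m,p)$, $\Psi_4=C(p,n,p,n)$. The selfdual totally null plane ${\rm Span}_{\mathbb C}(m+zn,k-zp)$ (or ${\rm Span}_{\mathbb C}(n,p)$ for $z=\infty$) is principal if $z$ is a root in $\mathbb C\cup\{\infty\}$ of $\Psi_4z^4-4\Psi_3z^3+6\Psi_2z^2+4\Psi_1z+\Psi_0$, and multiple principal if $z$ is a multiple root. The selfdual part of the Weyl tensor is algebraically special at a point if a multiple principal plane exists there. In a frame with $\mathcal N={\rm Span}_{\mathbb C}(m,k)$, $\mathcal N$ is multiple principal iff $\Psi_0\equiv\Psi_1\equiv0$. Petrov types of the selfdual part of the Weyl tensor at a point: type III if the quartic has a root of multiplicity exactly three, type N if it has a root of multiplicity four, type 0 if the selfdual part vanishes. The metric $g$ is II-generic if the set of points where its selfdual part of the Weyl tensor is of type III, N or 0 is contained in closed sets without interior in $\mathcal M$. *)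

(* Defs.v *)
From HB Require Import structures.
From mathcomp Require Import all_boot all_order all_algebra.
From mathcomp Require Import all_classical all_reals all_analysis.
From mathcomp Require Import complex.
Set Implicit Arguments.
Unset Strict Implicit.
Unset Printing Implicit Defensive.
Import Order.TTheory GRing.Theory Num.Theory.
Import numFieldNormedType.Exports.
Local Open Scope classical_set_scope.
Local Open Scope ring_scope.

Section Calculus.
Variable R : realType.
Local Notation C := R[i].

Definition partial (a : 'I_4) (f : 'rV[R]_4 -> R) (u : 'rV[R]_4) : R :=
  'D_(delta_mx 0 a) f u.

(* f is C^oo on the open set U: all its iterated partial derivatives exist
   and are Frechet differentiable at every point of U. *)
Definition smooth_on (U : set 'rV[R]_4) (f : 'rV[R]_4 -> R) : Prop :=
  forall (s : seq 'I_4) u, U u -> differentiable (foldr partial f s) u.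

Definition csmooth_on (U : set 'rV[R]_4) (f : 'rV[R]_4 -> C) : Prop :=
  smooth_on U (fun u => complex.Re (f u)) /\
  smooth_on U (fun u => complex.Im (f u)).

Definition cpartial (a : 'I_4) (f : 'rV[R]_4 -> C) (u : 'rV[R]_4) : C :=
  Complex (partial a (fun v => complex.Re (f v)) u)
          (partial a (fun v => complex.Im (f v)) u).

(* Complexified vector fields, in coordinates. *)
Definition smooth_vector_on (U : set 'rV[R]_4) (X : 'rV[R]_4 -> 'rV[C]_4) :=
  forall a, csmooth_on U (fun u => X u 0 a).

Definition lie_bracket (X Y : 'rV[R]_4 -> 'rV[C]_4) (u : 'rV[R]_4) :
    'rV[C]_4 :=
  \row_a \sum_b (X u 0 b * cpartial b (fun v => Y v 0 a) u
                 - Y u 0 b * cpartial b (fun v => X v 0 a) u).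

End Calculus.

Section Curvature.
Variable R : realType.
Local Notation C := R[i].
(* G u is the matrix g_{ab} of the metric at the coordinate point u. *)
Variable G : 'rV[R]_4 -> 'M[C]_4.

(* Gamma^a_{bc}, with nabla_{e_b} e_c = Gamma^a_{bc} e_a. *)
Definition christoffel (a b c : 'I_4) (u : 'rV[R]_4) : C :=
  2^-1 * \sum_d invmx (G u) a d *
    (cpartial b (fun v => G v d c) u + cpartial c (fun v => G v d b) u
     - cpartial d (fun v => G v b c) u).

(* R^a_{bcd}, with R(e_c, e_d) e_b = R^a_{bcd} e_a. *)
Definition riemann_up (a b c d : 'I_4) (u : 'rV[R]_4) : C :=
  cpartial c (christoffel a d b) u - cpartial d (christoffel a c b) u
  + \sum_e (christoffel a c e u * christoffel e d b u
            - christoffel a d e u * christoffel e c b u).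

Definition riemann (a b c d : 'I_4) (u : 'rV[R]_4) : C :=
  \sum_e G u a e * riemann_up e b c d u.

Definition ricci (a b : 'I_4) (u : 'rV[R]_4) : C :=
  \sum_c riemann_up c a c b u.

Definition scalar_curvature (u : 'rV[R]_4) : C :=
  \sum_a \sum_b invmx (G u) a b * ricci a b u.

Definition schouten (a b : 'I_4) (u : 'rV[R]_4) : C :=
  2^-1 * ricci a b u - 12^-1 * scalar_curvature u * G u a b.

Definition weyl (a b c d : 'I_4) (u : 'rV[R]_4) : C :=
  riemann a b c d u + G u a d * schouten c b u - G u a c * schouten d b u
  + G u b c * schouten d a u - G u b d * schouten c a u.

(* nabla_a P_{bc} *)
Definition nabla_schouten (a b c : 'I_4) (u : 'rV[R]_4) : C :=
  cpartial a (schouten b c) u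
  - \sum_e (christoffel e a b u * schouten e c u
            + christoffel e a c u * schouten b e u).

Definition cotton (a b c : 'I_4) (u : 'rV[R]_4) : C :=
  nabla_schouten b c a u - nabla_schouten c b a u.

Definition weyl_form (u : 'rV[R]_4) (v1 v2 v3 v4 : 'rV[C]_4) : C :=
  \sum_a \sum_b \sum_c \sum_d
    weyl a b c d u * v1 0 a * v2 0 b * v3 0 c * v4 0 d.

Definition cotton_form (u : 'rV[R]_4) (v1 v2 v3 : 'rV[C]_4) : C :=
  \sum_a \sum_b \sum_c cotton a b c u * v1 0 a * v2 0 b * v3 0 c.

End Curvature.

Section Pointwise.
Variable R : realType.
Local Notation C := R[i].
(* h is the matrix g_{ab} of the metric at a point and w the component
   eps_{0123} of the volume form at that point. *)
Variables (h : 'M[C]_4) (w : C).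

Definition gdot (v1 v2 : 'rV[C]_4) : C := (v1 *m h *m v2^T) 0 0.

Definition totally_null (W : {vspace 'rV[C]_4}) : Prop :=
  forall v1 v2, v1 \in W -> v2 \in W -> gdot v1 v2 = 0.

Definition levi_civita (a b c d : 'I_4) : C :=
  \det (\matrix_(i < 4, j < 4) (nth a [:: a; b; c; d] i == j)%:R).

(* A bivector is an antisymmetric matrix F^{ab}; its dual is
   1/2 g^{ac} g^{bd} eps_{cdef} F^{ef}. *)
Definition hodge (F : 'M[C]_4) : 'M[C]_4 :=
  \matrix_(a, b) (2^-1 * \sum_c \sum_d \sum_e \sum_f
    invmx h a c * invmx h b d * (w * levi_civita c d e f) * F e f).

Definition wedge (v1 v2 : 'rV[C]_4) : 'M[C]_4 :=
  v1^T *m v2 - v2^T *m v1.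

Definition selfdual_plane (W : {vspace 'rV[C]_4}) : Prop :=
  forall v1 v2, v1 \in W -> v2 \in W ->
    hodge (wedge v1 v2) = wedge v1 v2.

(* Nondegeneracy of the Gram matrix makes these four vectors a basis. *)
Definition null_frame (m p n k : 'rV[C]_4) : Prop :=
  [/\ gdot m p = 1, gdot n k = 1,
      [/\ gdot m m = 0, gdot p p = 0, gdot n n = 0 & gdot k k = 0] &
      [/\ gdot m n = 0, gdot m k = 0, gdot p n = 0 & gdot p k = 0]].

Definition sd_null_frame (m p n k : 'rV[C]_4) : Prop :=
  null_frame m p n k /\ selfdual_plane <<[:: m; k]>>%VS.

(* The parameter z ranges over C together with oo, encoded as None. *)
Definition null_plane (m p n k : 'rV[C]_4) (z : option C) :
    {vspace 'rV[C]_4} :=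
  if z is Some z then <<[:: (m + z *: n)%R; (k - z *: p)%R]>>%VS
  else <<[:: n; p]>>%VS.

End Pointwise.

(* z is a root of multiplicity at least r of q, viewed as a polynomial of
   formal degree 4: the multiplicity of oo is 4 - deg q = 5 - size q.  Every z
   counts as a root of the zero polynomial, of every multiplicity r <= 4. *)
Definition mult_ge (F : fieldType) (r : nat) (q : {poly F}) (z : option F) :
    bool :=
  if z is Some z then ('X - z%:P) ^+ r %| q else (size q + r <= 5)%N.

Section Petrov.
Variable R : realType.
Local Notation C := R[i].
Variables (G : 'rV[R]_4 -> 'M[C]_4) (u : 'rV[R]_4) (w : C).
Local Notation W := (weyl_form G u).

Definition Psi0 (m p n k : 'rV[C]_4) : C := W m k m k.
Definition Psi1 (m p n k : 'rV[C]_4) : C := W m k n k.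
Definition Psi2 (m p n k : 'rV[C]_4) : C := W m k p n.
Definition Psi3 (m p n k : 'rV[C]_4) : C := W p n m p.
Definition Psi4 (m p n k : 'rV[C]_4) : C := W p n p n.

Definition petrov_quartic (m p n k : 'rV[C]_4) : {poly C} :=
  Psi4 m p n k *: 'X^4 - (4 * Psi3 m p n k) *: 'X^3
  + (6 * Psi2 m p n k) *: 'X^2 + (4 * Psi1 m p n k) *: 'X
  + (Psi0 m p n k)%:P.

(* A point where the selfdual part vanishes is algebraically special and all
   its selfdual null planes are multiple principal.  The notions below do not
   depend on the choice of the null frame with Span(m, k) selfdual. *)
Definition multiple_principal_plane (V : {vspace 'rV[C]_4}) : Prop :=
  exists m p n k z, [/\ sd_null_frame (G u) w m p n k,
    V = null_plane m p n k z & mult_ge 2 (petrov_quartic m p n k) z].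

Definition sd_weyl_special : Prop :=
  exists V, multiple_principal_plane V.

Definition petrov_III : Prop :=
  exists m p n k z, [/\ sd_null_frame (G u) w m p n k,
    mult_ge 3 (petrov_quartic m p n k) z &
    ~~ mult_ge 4 (petrov_quartic m p n k) z].

Definition petrov_N : Prop :=
  exists m p n k z, [/\ sd_null_frame (G u) w m p n k,
    petrov_quartic m p n k != 0 &
    mult_ge 4 (petrov_quartic m p n k) z].

(* Psi0, ..., Psi4 are all the components of the selfdual part. *)
Definition petrov_0 : Prop :=
  exists m p n k, sd_null_frame (G u) w m p n k /\
    [/\ Psi0 m p n k = 0, Psi1 m p n k = 0, Psi2 m p n k = 0,
        Psi3 m p n k = 0 & Psi4 m p n k = 0].

End Petrov.

(* A chart is a homeomorphism from an open set onto an open set of R^4;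
   chart_map and chart_inv are only meaningful on chart_dom and chart_img. *)
Record chart (R : realType) (M : topologicalType) := Chart {
  chart_dom : set M;
  chart_map : M -> 'rV[R]_4;
  chart_inv : 'rV[R]_4 -> M;
  chart_dom_open : open chart_dom;
  chart_img_open : open (chart_map @` chart_dom);
  chart_mapK : forall x, chart_dom x -> chart_inv (chart_map x) = x;
  chart_map_cont : forall x, chart_dom x -> {for x, continuous chart_map};
  chart_inv_cont : forall u, (chart_map @` chart_dom) u ->
    {for u, continuous chart_inv}
}.

Definition chart_img (R : realType) (M : topologicalType) (c : chart R M) :
    set 'rV[R]_4 := chart_map c @` chart_dom c.

(* The change of coordinates from c to c', the open set of coordinates where
   it is defined, and its Jacobian acting on row vectors from the right. *)
Definition transition (R : realType) (M : topologicalType) (c c' : chart R M) :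
    'rV[R]_4 -> 'rV[R]_4 := fun u => chart_map c' (chart_inv c u).

Definition overlap (R : realType) (M : topologicalType) (c c' : chart R M) :
    set 'rV[R]_4 := chart_map c @` (chart_dom c `&` chart_dom c').

Definition transition_jacobian (R : realType) (M : topologicalType)
    (c c' : chart R M) (u : 'rV[R]_4) : 'M[R[i]]_4 :=
  map_mx (real_complex R) (jacobian (transition c c') u).

Record smooth_atlas (R : realType) (M : topologicalType) := SmoothAtlas {
  chart_index : Type;
  chart_at :> chart_index -> chart R M;
  chart_cover : forall x, exists i, chart_dom (chart_at i) x;
  chart_smooth : forall i j (a : 'I_4),
    smooth_on (overlap (chart_at i) (chart_at j))
      (fun u => transition (chart_at i) (chart_at j) u 0 a)
}.

Section Fields.
Variables (R : realType) (M : topologicalType) (A : smooth_atlas R M).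
Local Notation C := R[i].

(* Tensor fields on M are families of components, one for each chart, that
   are smooth on the image of the chart and obey the transformation law. *)

Record complex_metric := ComplexMetric {
  metric_mx :> chart_index A -> 'rV[R]_4 -> 'M[C]_4;
  metric_smooth : forall i (a b : 'I_4),
    csmooth_on (chart_img (A i)) (fun u => metric_mx i u a b);
  metric_sym : forall i u, chart_img (A i) u ->
    (metric_mx i u)^T = metric_mx i u;
  metric_nondeg : forall i u, chart_img (A i) u ->
    metric_mx i u \in unitmx;
  metric_transform : forall i j u, overlap (A i) (A j) u ->
    let J := transition_jacobian (A i) (A j) u in
    metric_mx i u = J *m metric_mx j (transition (A i) (A j) u) *m J^T
}.

(* An orientation is a volume form, possibly complex-valued, given by its
   component eps_{0123} and normalized so that the Hodge star squares to the
   identity on bivectors; this fixes it up to sign.  For a real metric of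
   Lorentzian signature it is i times a real volume form. *)
Record orientation (g : complex_metric) := Orientation {
  volume :> chart_index A -> 'rV[R]_4 -> C;
  volume_smooth : forall i, csmooth_on (chart_img (A i)) (volume i);
  volume_transform : forall i j u, overlap (A i) (A j) u ->
    volume i u = \det (transition_jacobian (A i) (A j) u)
                 * volume j (transition (A i) (A j) u);
  volume_normalized : forall i u, chart_img (A i) u ->
    forall F : 'M[C]_4, F^T = - F ->
      hodge (g i u) (volume i u) (hodge (g i u) (volume i u) F) = F
}.

(* A smooth complex rank-2 subbundle of the complexified tangent bundle. *)
Record plane_field := PlaneField {
  plane_at :> chart_index A -> 'rV[R]_4 -> {vspace 'rV[C]_4};
  plane_dim : forall i u, chart_img (A i) u -> (\dim (plane_at i u) = 2)%N;
  plane_smooth : forall i u, chart_img (A i) u ->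
    exists (U : set 'rV[R]_4) (X Y : 'rV[R]_4 -> 'rV[C]_4),
      [/\ [/\ open U, U u & U `<=` chart_img (A i)],
          smooth_vector_on U X, smooth_vector_on U Y &
          forall v, U v -> plane_at i v = <<[:: X v; Y v]>>%VS];
  plane_transform : forall i j u, overlap (A i) (A j) u ->
    forall v, v \in plane_at i u ->
      v *m transition_jacobian (A i) (A j) u
        \in plane_at j (transition (A i) (A j) u)
}.

Variables (g : complex_metric) (o : orientation g) (N : plane_field).

Definition sd_null_field : Prop :=
  forall i u, chart_img (A i) u ->
    totally_null (g i u) (N i u) /\ selfdual_plane (g i u) (o i u) (N i u).

Definition cotton_degenerate : Prop :=
  forall i u, chart_img (A i) u ->
    forall Z1 Z2 Z3, Z1 \in N i u -> Z2 \in N i u -> Z3 \in N i u ->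
      cotton_form (g i) u Z1 Z2 Z3 = 0.

(* Involutivity: brackets of local sections of N are sections of N. *)
Definition integrable_field : Prop :=
  forall i (U : set 'rV[R]_4) (X Y : 'rV[R]_4 -> 'rV[C]_4),
    open U -> U `<=` chart_img (A i) ->
    smooth_vector_on U X -> smooth_vector_on U Y ->
    (forall u, U u -> X u \in N i u /\ Y u \in N i u) ->
    forall u, U u -> lie_bracket X Y u \in N i u.

Definition multiple_principal_field : Prop :=
  forall i u, chart_img (A i) u ->
    sd_weyl_special (g i) u (o i u) /\
    multiple_principal_plane (g i) u (o i u) (N i u).

Definition type_III_N_0_set : set M :=
  [set x | exists i, chart_dom (A i) x /\
    let u := chart_map (A i) x in
    [\/ petrov_III (g i) u (o i u), petrov_N (g i) u (o i u) |
        petrov_0 (g i) u (o i u)]].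

Definition II_generic : Prop :=
  exists K : set M, [/\ closed K, interior K = set0 &
                        type_III_N_0_set `<=` K].

End Fields.

(* Main.v *)
Require Import Defs.
From HB Require Import structures.
From mathcomp Require Import all_boot all_order all_algebra.
From mathcomp Require Import all_classical all_reals all_analysis.
From mathcomp Require Import complex ring lra.

(** The proof is local. Let [m], [k] span [N], complete them to a null frame
    [m, p, n, k], and put [omega Z = g (nabla_Z m, k)]. As [N] is totally null,
    it is integrable iff [omega] vanishes on it, and then [Psi0 = 0].
    If [Psi0 = 0], two components of the second Bianchi identity give,
    for [Z = m, k],
      [Z Psi1 = lambda Z * Psi1 + 3 * omega Z * Psi2 + A (Z, m, k)]
    with [lambda] a combination of connection coefficients.
    Where [Psi0 = Psi1 = 0] this reads [A (Z, m, k) = - 3 * omega Z * Psi2]; as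
    [Psi2] is nonzero on a dense set in the II-generic case, [omega] and [A]
    vanish on [N] together.  If instead [omega] and [A] vanish on [N], then
    [Psi1] is parallel along [N] for the partial connection [lambda]. The
    curvature of [lambda] is [10 * Psi1], hence [10 * Psi1 ^ 2 = 0]. *)

Set Implicit Arguments.
Unset Strict Implicit.
Unset Printing Implicit Defensive.
Import Order.TTheory GRing.Theory Num.Theory.
Import numFieldNormedType.Exports.
Local Open Scope ring_scope.

(** * Vector fields over a ring with commuting derivations *)

(** The tensor identities are proved over an abstract commutative ring with commuting derivations,
    where they become polynomial identities in frame components. The ring is then instantiated by
    the smooth functions on an open set of a chart, and evaluation at a point recovers the
    coordinate tensors. Smooth functions have zero divisors, so only units are cancelled in that
    ring: [Psi1 ^ 2] is reduced to [Psi1] after evaluation, and the factor [Psi2] is removed by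
    density. The constant [10] arises as follows. The Bianchi components give
    [lambda m = tau m - 4 * omega n] and [lambda k = tau k + 4 * omega p], where [tau] is the
    connection form of the second exterior power of [N]. Along [N] the curvature of [tau] is
    [2 * Psi1], and the [omega] terms add [4 * (2 * Psi1)]. A parallel section is annihilated by the
    curvature of its connection; here the section is itself proportional to that curvature, whence
    the square. II-genericity controls [Psi2] because, where [Psi0 = Psi1 = 0], the root [0] of the
    quartic has multiplicity at least three exactly when [Psi2 = 0]. *)

Section Multilinear.
Variables (A : comPzRingType) (n : nat).
Implicit Types V W X Y Z : 'rV[A]_n.

Lemma rowD V W i : (V + W) 0 i = V 0 i + W 0 i. Proof. exact: mxE. Qed.
Lemma rowN V i : (- V) 0 i = - V 0 i. Proof. exact: mxE. Qed.
Lemma rowZ x V i : (x *: V) 0 i = x * V 0 i. Proof. exact: mxE. Qed.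
Definition rowE := (rowD, rowN, rowZ).

Lemma linear_row_sum (E : lmodType A) (F : 'rV[A]_n -> E) :
  (forall x V W, F (x *: V + W) = x *: F V + F W) ->
  forall V, F V = \sum_i V 0 i *: F (delta_mx 0 i).
Proof.
move=> Flin V.
have F0 : F 0 = 0.
  have := Flin 1 0 0; rewrite !scale1r addr0 => /(congr1 (+%R (- F 0))).
  by rewrite addNr addrA addNr add0r.
rewrite {1}(row_sum_delta V); elim/big_rec2: _ => [//|i y1 y2 _ <-].
by rewrite Flin.
Qed.

Lemma scalar_row_sum (F : 'rV[A]_n -> A) :
  (forall x V W, F (x *: V + W) = x * F V + F W) ->
  forall V, F V = \sum_i V 0 i * F (delta_mx 0 i).
Proof. by move=> /(@linear_row_sum A^o F). Qed.

(** These forms are written exactly like [weyl_form] and [cotton_form], so that results about them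
    apply to those by conversion. *)
Definition form2 (T : 'I_n -> 'I_n -> A) V1 V2 : A :=
  \sum_a \sum_b T a b * V1 0 a * V2 0 b.
Definition form3 (T : 'I_n -> 'I_n -> 'I_n -> A) V1 V2 V3 : A :=
  \sum_a \sum_b \sum_c T a b c * V1 0 a * V2 0 b * V3 0 c.
Definition form4 (T : 'I_n -> 'I_n -> 'I_n -> 'I_n -> A) V1 V2 V3 V4 : A :=
  \sum_a \sum_b \sum_c \sum_d
    T a b c d * V1 0 a * V2 0 b * V3 0 c * V4 0 d.

Lemma form2_lin1 T x V W V2 :
  form2 T (x *: V + W) V2 = x * form2 T V V2 + form2 T W V2.
Proof.
rewrite mulr_sumr -big_split; apply: eq_bigr => a _ /=.
rewrite mulr_sumr -big_split; apply: eq_bigr => b _ /=.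
by rewrite !rowE; ring.
Qed.

Lemma form2_lin2 T x V W V1 :
  form2 T V1 (x *: V + W) = x * form2 T V1 V + form2 T V1 W.
Proof.
rewrite mulr_sumr -big_split; apply: eq_bigr => a _ /=.
rewrite mulr_sumr -big_split; apply: eq_bigr => b _ /=.
by rewrite !rowE; ring.
Qed.

Lemma form3_lin1 T x V W V2 V3 :
  form3 T (x *: V + W) V2 V3 = x * form3 T V V2 V3 + form3 T W V2 V3.
Proof.
do 3!(rewrite mulr_sumr -big_split; apply: eq_bigr => ? _ /=).
by rewrite !rowE; ring.
Qed.

Lemma form3_lin2 T x V W V1 V3 :
  form3 T V1 (x *: V + W) V3 = x * form3 T V1 V V3 + form3 T V1 W V3.
Proof.
do 3!(rewrite mulr_sumr -big_split; apply: eq_bigr => ? _ /=).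
by rewrite !rowE; ring.
Qed.

Lemma form3_lin3 T x V W V1 V2 :
  form3 T V1 V2 (x *: V + W) = x * form3 T V1 V2 V + form3 T V1 V2 W.
Proof.
do 3!(rewrite mulr_sumr -big_split; apply: eq_bigr => ? _ /=).
by rewrite !rowE; ring.
Qed.

Lemma form4_lin1 T x V W V2 V3 V4 : form4 T (x *: V + W) V2 V3 V4 =
  x * form4 T V V2 V3 V4 + form4 T W V2 V3 V4.
Proof.
do 4!(rewrite mulr_sumr -big_split; apply: eq_bigr => ? _ /=).
by rewrite !rowE; ring.
Qed.

Lemma form4_lin2 T x V W V1 V3 V4 : form4 T V1 (x *: V + W) V3 V4 =
  x * form4 T V1 V V3 V4 + form4 T V1 W V3 V4.
Proof.
do 4!(rewrite mulr_sumr -big_split; apply: eq_bigr => ? _ /=).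
by rewrite !rowE; ring.
Qed.

Lemma form4_lin3 T x V W V1 V2 V4 : form4 T V1 V2 (x *: V + W) V4 =
  x * form4 T V1 V2 V V4 + form4 T V1 V2 W V4.
Proof.
do 4!(rewrite mulr_sumr -big_split; apply: eq_bigr => ? _ /=).
by rewrite !rowE; ring.
Qed.

Lemma form4_lin4 T x V W V1 V2 V3 : form4 T V1 V2 V3 (x *: V + W) =
  x * form4 T V1 V2 V3 V + form4 T V1 V2 V3 W.
Proof.
do 4!(rewrite mulr_sumr -big_split; apply: eq_bigr => ? _ /=).
by rewrite !rowE; ring.
Qed.

Section Linear.
Variable F : 'rV[A]_n -> A.
Hypothesis Flin : forall x V W, F (x *: V + W) = x * F V + F W.
Lemma lin_add V W : F (V + W) = F V + F W.
Proof. by rewrite -[V]scale1r Flin scale1r mul1r. Qed.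
Lemma lin_zero : F 0 = 0.
Proof. by apply: (addrI (F 0)); rewrite -lin_add !addr0. Qed.
Lemma lin_scale x V : F (x *: V) = x * F V.
Proof. by rewrite -[x *: V]addr0 Flin lin_zero addr0. Qed.
Lemma lin_sum4 x1 x2 x3 x4 V1 V2 V3 V4 :
  F (x1 *: V1 + x2 *: V2 + x3 *: V3 + x4 *: V4) =
  x1 * F V1 + x2 * F V2 + x3 * F V3 + x4 * F V4.
Proof. by rewrite !lin_add !lin_scale. Qed.
End Linear.

Lemma form2D1 T V1 V2 W :
  form2 T (V1 + V2) W = form2 T (V1) W + form2 T (V2) W.
Proof. by apply: (lin_add (F := (form2 T)^~ W)) => *; apply: form2_lin1. Qed.
Lemma form2Z1 T x V W : form2 T (x *: V) W = x * form2 T (V) W.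
Proof. by apply: (lin_scale (F := (form2 T)^~ W)) => *; apply: form2_lin1. Qed.

Lemma form2D2 T V1 V2 W :
  form2 T W (V1 + V2) = form2 T W (V1) + form2 T W (V2).
Proof. by apply: (lin_add (F := form2 T W)) => *; apply: form2_lin2. Qed.
Lemma form2Z2 T x V W : form2 T W (x *: V) = x * form2 T W (V).
Proof. by apply: (lin_scale (F := form2 T W)) => *; apply: form2_lin2. Qed.

Lemma sum_delta_mx (f : 'I_n -> A) i :
  \sum_j f j * (delta_mx 0 i : 'rV[A]_n) 0 j = f i.
Proof.
rewrite (bigD1 i) //= big1 ?addr0 => [|j ji]; first by rewrite mxE !eqxx mulr1.
by rewrite mxE (negPf ji) andbF mulr0.
Qed.

Lemma form2_delta T a b : form2 T (delta_mx 0 a) (delta_mx 0 b) = T a b.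
Proof.
rewrite /form2 (eq_bigr _ (fun i _ => sum_delta_mx _ b)).
by rewrite sum_delta_mx.
Qed.

(** The tensoriality principle: an expression that may contain derivatives, but is linear over the
    ring in each slot, is determined by its values on coordinate fields. With its analogues for
    three and four slots it links coordinate-free and coordinate formulas. *)
Lemma form2E (F : 'rV[A]_n -> 'rV[A]_n -> A) :
  (forall x V W V2, F (x *: V + W) V2 = x * F V V2 + F W V2) ->
  (forall x V W V1, F V1 (x *: V + W) = x * F V1 V + F V1 W) ->
  forall V1 V2,
  F V1 V2 = form2 (fun a b => F (delta_mx 0 a) (delta_mx 0 b)) V1 V2.
Proof.
move=> F1 F2 V1 V2.
rewrite (@scalar_row_sum (F^~ V2)) //; apply: eq_bigr => a _.
rewrite (@scalar_row_sum (F _)); last by move=> *.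
by rewrite mulr_sumr; apply: eq_bigr => b _; ring.
Qed.

Lemma form3E (F : 'rV[A]_n -> 'rV[A]_n -> 'rV[A]_n -> A) :
  (forall x V W V2 V3, F (x *: V + W) V2 V3 = x * F V V2 V3 + F W V2 V3) ->
  (forall x V W V1 V3, F V1 (x *: V + W) V3 = x * F V1 V V3 + F V1 W V3) ->
  (forall x V W V1 V2, F V1 V2 (x *: V + W) = x * F V1 V2 V + F V1 V2 W) ->
  forall V1 V2 V3, F V1 V2 V3 =
    form3 (fun a b c => F (delta_mx 0 a) (delta_mx 0 b) (delta_mx 0 c))
      V1 V2 V3.
Proof.
move=> F1 F2 F3 V1 V2 V3.
rewrite (@scalar_row_sum (fun V => F V V2 V3)) //; apply: eq_bigr => a _.
rewrite (@form2E (F (delta_mx 0 a))); [|by move=> *|by move=> *].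
rewrite mulr_sumr; apply: eq_bigr => b _.
by rewrite mulr_sumr; apply: eq_bigr => c _; ring.
Qed.

Lemma form4E (F : 'rV[A]_n -> 'rV[A]_n -> 'rV[A]_n -> 'rV[A]_n -> A) :
  (forall x V W V2 V3 V4,
     F (x *: V + W) V2 V3 V4 = x * F V V2 V3 V4 + F W V2 V3 V4) ->
  (forall x V W V1 V3 V4,
     F V1 (x *: V + W) V3 V4 = x * F V1 V V3 V4 + F V1 W V3 V4) ->
  (forall x V W V1 V2 V4,
     F V1 V2 (x *: V + W) V4 = x * F V1 V2 V V4 + F V1 V2 W V4) ->
  (forall x V W V1 V2 V3,
     F V1 V2 V3 (x *: V + W) = x * F V1 V2 V3 V + F V1 V2 V3 W) ->
  forall V1 V2 V3 V4, F V1 V2 V3 V4 =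
    form4 (fun a b c d => F (delta_mx 0 a) (delta_mx 0 b) (delta_mx 0 c)
             (delta_mx 0 d)) V1 V2 V3 V4.
Proof.
move=> F1 F2 F3 F4 V1 V2 V3 V4.
rewrite (@scalar_row_sum (fun V => F V V2 V3 V4)) //; apply: eq_bigr => a _.
rewrite (@form3E (F (delta_mx 0 a))); [|by move=> *|by move=> *|by move=> *].
rewrite mulr_sumr; apply: eq_bigr => b _.
rewrite mulr_sumr; apply: eq_bigr => c _.
by rewrite mulr_sumr; apply: eq_bigr => e _; ring.
Qed.

End Multilinear.

(** A model of the functions on a coordinate domain with their partial derivatives. Symmetry of
    second derivatives, [cderivC], is what makes brackets of fields act as commutators. *)
Record commuting_derivations (A : comPzRingType) (n : nat) := {
  cderiv :> 'I_n -> A -> A;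
  cderivD : forall a, {morph cderiv a : x y / x + y};
  cderivM : forall a x y, cderiv a (x * y) = cderiv a x * y + x * cderiv a y;
  cderivC : forall a b x, cderiv a (cderiv b x) = cderiv b (cderiv a x)
}.

Section VectorFields.
Variables (A : comPzRingType) (n : nat) (d : commuting_derivations A n).
Implicit Types (x y z : A) (V W X Y Z : 'rV[A]_n).

Lemma cderiv0 a : d a 0 = 0.
Proof.
have := cderivD d a 0 0; rewrite addr0 => /(congr1 (+%R (- d a 0))).
by rewrite addNr addrA addNr add0r.
Qed.

Lemma cderivN a x : d a (- x) = - d a x.
Proof. by apply: (addrI (d a x)); rewrite -cderivD !addrN cderiv0. Qed.

Lemma cderiv1 a : d a 1 = 0.
Proof.
have := cderivM d a 1 1; rewrite !mulr1 mul1r => /(congr1 (+%R (- d a 1))).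
by rewrite addNr addrA addNr add0r.
Qed.

Lemma cderiv_nat a m : d a m%:R = 0.
Proof.
by elim: m => [|m IH];
  rewrite ?cderiv0 // -addn1 natrD cderivD IH cderiv1 addr0.
Qed.

Lemma cderiv_delta a (i : 'I_1) (b j : 'I_n) :
  d a ((delta_mx i b : 'rV[A]_n) i j) = 0.
Proof. by rewrite mxE cderiv_nat. Qed.

Definition along V x : A := \sum_a V 0 a * d a x.

Lemma along_lin y V W x : along (y *: V + W) x = y * along V x + along W x.
Proof.
rewrite mulr_sumr -big_split; apply: eq_bigr => a _ /=; rewrite !rowE; ring.
Qed.

Lemma alongD V x y : along V (x + y) = along V x + along V y.
Proof. by rewrite -big_split; apply: eq_bigr => a _;
  rewrite cderivD mulrDr. Qed.

Lemma alongM V x y : along V (x * y) = along V x * y + x * along V y.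
Proof.
rewrite mulr_suml mulr_sumr -big_split; apply: eq_bigr => a _ /=.
by rewrite cderivM; ring.
Qed.

Lemma along0 V : along V 0 = 0.
Proof. by rewrite /along big1 // => a _; rewrite cderiv0 mulr0. Qed.

Lemma alongN V x : along V (- x) = - along V x.
Proof. by rewrite /along -sumrN; apply: eq_bigr => a _;
  rewrite cderivN mulrN. Qed.

Lemma along_nat V m : along V m%:R = 0.
Proof. by rewrite /along big1 // => a _; rewrite cderiv_nat mulr0. Qed.

Lemma along_sum V (I : Type) (r : seq I) (P : pred I) (F : I -> A) :
  along V (\sum_(i <- r | P i) F i) = \sum_(i <- r | P i) along V (F i).
Proof. exact: (big_morph _ (alongD V) (along0 V)). Qed.

Lemma along_delta a x : along (delta_mx 0 a) x = d a x.
Proof.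
by rewrite -[RHS](sum_delta_mx (d^~ x) a); apply: eq_bigr => b _; rewrite mulrC.
Qed.

Definition lie V W : 'rV[A]_n := \row_a (along V (W 0 a) - along W (V 0 a)).

Lemma lieE V W a : lie V W 0 a = along V (W 0 a) - along W (V 0 a).
Proof. by rewrite mxE. Qed.

Lemma lieC V W : lie W V = - lie V W.
Proof. by apply/rowP => a; rewrite rowN !lieE; ring. Qed.

(** The second-order terms of the two compositions agree because the derivations commute, so only
    the derivatives of the coefficients remain. *)
Lemma along_lie V W x :
  along (lie V W) x = along V (along W x) - along W (along V x).
Proof.
rewrite {1}/along [along W x]/along [along V x]/along !along_sum -sumrB.
rewrite (eq_bigr (fun a => along V (W 0 a) * d a x - along W (V 0 a) * d a x));
  last by move=> a _; rewrite lieE mulrBl.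
rewrite !sumrB.
rewrite (eq_bigr (fun a => along V (W 0 a * d a x) - W 0 a * along V (d a x)));
  last by move=> a _; rewrite alongM addrK.
rewrite [X in _ - X](eq_bigr (fun a => along W (V 0 a * d a x)
    - V 0 a * along W (d a x))); last by move=> a _; rewrite alongM addrK.
rewrite !sumrB.
have -> : \sum_a W 0 a * along V (d a x) = \sum_a V 0 a * along W (d a x).
  under eq_bigr do rewrite mulr_sumr; rewrite exchange_big /=.
  apply: eq_bigr => a _; rewrite mulr_sumr; apply: eq_bigr => b _.
  by rewrite (cderivC d); ring.
by ring.
Qed.

Lemma lie_jacobi X Y Z :
  lie (lie X Y) Z + lie (lie Y Z) X + lie (lie Z X) Y = 0.
Proof.
apply/rowP => a; rewrite !rowE !lieE !along_lie !alongD !alongN mxE.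
by ring.
Qed.

Lemma lie_lin1 x V W Z :
  lie (x *: V + W) Z = x *: lie V Z + lie W Z - along Z x *: V.
Proof.
apply/rowP => a; rewrite !(rowE, lieE) along_lin alongD alongM.
by ring.
Qed.

End VectorFields.

(** * The Levi-Civita connection *)

(** Inverses are part of the data because the ring has no division. The number [12] is the only one
    to invert: it serves the Schouten tensor, and six times its inverse is the half in the
    Christoffel symbols. *)
Record ring_metric (A : comPzRingType) (n : nat) := {
  gmx : 'M[A]_n;
  ginv : 'M[A]_n;
  twelfth : A;
  gmx_sym : gmx^T = gmx;
  gmxV : ginv *m gmx = 1%:M;
  twelfthE : 12%:R * twelfth = 1
}.

Section LeviCivita.
Variables (A : comPzRingType) (n : nat).
Variables (d : commuting_derivations A n) (g : ring_metric A n).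
Implicit Types (x y z : A) (V W X Y Z : 'rV[A]_n).

Definition rhalf : A := 6%:R * twelfth g.

Lemma halfE : 2%:R * rhalf = 1.
Proof. by rewrite /rhalf mulrA -natrM twelfthE. Qed.

Lemma mul2I x y : x + x = y + y -> x = y.
Proof.
rewrite -!mulr2n -[x *+ 2]mulr_natl -[y *+ 2]mulr_natl.
by move/(congr1 ( *%R rhalf)); rewrite !mulrA ![rhalf * _]mulrC halfE !mul1r.
Qed.

Lemma gmxC a b : gmx g a b = gmx g b a.
Proof. by rewrite -{1}(gmx_sym g) mxE. Qed.

Lemma gmxVr : gmx g *m ginv g = 1%:M.
Proof. by apply: mulmx1C; apply: gmxV. Qed.

Lemma sum_gmxV a b : \sum_c gmx g a c * ginv g c b = (a == b)%:R.
Proof. by have := congr1 (fun M : 'M[A]_n => M a b) gmxVr; rewrite !mxE. Qed.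

Definition rdot V W : A := form2 (gmx g) V W.

Lemma dotC V W : rdot V W = rdot W V.
Proof.
rewrite /rdot /form2 exchange_big; apply: eq_bigr => a _.
by apply: eq_bigr => b _; rewrite gmxC; ring.
Qed.

Lemma dot_lin1 x V W Z : rdot (x *: V + W) Z = x * rdot V Z + rdot W Z.
Proof. exact: form2_lin1. Qed.

Lemma dot_lin2 x V W Z : rdot Z (x *: V + W) = x * rdot Z V + rdot Z W.
Proof. exact: form2_lin2. Qed.

Lemma dotD1 V W Z : rdot (V + W) Z = rdot V Z + rdot W Z.
Proof. exact: form2D1. Qed.
Lemma dotD2 V W Z : rdot Z (V + W) = rdot Z V + rdot Z W.
Proof. exact: form2D2. Qed.
Lemma dotZ1 x V Z : rdot (x *: V) Z = x * rdot V Z.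
Proof. exact: form2Z1. Qed.
Lemma dotZ2 x V Z : rdot Z (x *: V) = x * rdot Z V.
Proof. exact: form2Z2. Qed.
Lemma dotN1 V Z : rdot (- V) Z = - rdot V Z.
Proof. by rewrite -scaleN1r dotZ1 mulN1r. Qed.
Lemma dotN2 V Z : rdot Z (- V) = - rdot Z V.
Proof. by rewrite !(dotC Z) dotN1. Qed.
Lemma dot02 Z : rdot Z 0 = 0.
Proof. by apply: (addrI (rdot Z 0)); rewrite -dotD2 !addr0. Qed.
Lemma dotB1 V W Z : rdot (V - W) Z = rdot V Z - rdot W Z.
Proof. by rewrite dotD1 dotN1. Qed.
Lemma dotB2 V W Z : rdot Z (V - W) = rdot Z V - rdot Z W.
Proof. by rewrite dotD2 dotN2. Qed.

(* The prefix [r] marks the counterparts, over a ring with derivations, of the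
   coordinate tensors of [Defs]. *)
Definition rchristoffel a b c : A := rhalf * \sum_e ginv g a e *
  (d b (gmx g e c) + d c (gmx g e b) - d e (gmx g b c)).

Lemma chrC a b c : rchristoffel a b c = rchristoffel a c b.
Proof.
congr (_ * _); apply: eq_bigr => e _; congr (_ * _).
by rewrite (gmxC b c); ring.
Qed.

Lemma lower_chr a b c : \sum_e gmx g a e * rchristoffel e b c =
  rhalf * (d b (gmx g a c) + d c (gmx g a b) - d a (gmx g b c)).
Proof.
rewrite /rchristoffel; under eq_bigr do rewrite mulrCA mulr_sumr.
rewrite -mulr_sumr exchange_big /=; congr (_ * _).
under eq_bigr do under eq_bigr do rewrite mulrA.
under eq_bigr do rewrite -mulr_suml sum_gmxV.
rewrite (bigD1 a) //= eqxx mul1r big1 ?addr0 // => e /negPf.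
by rewrite eq_sym => ->; rewrite mul0r.
Qed.

Definition nabla V W : 'rV[A]_n :=
  \row_a (along d V (W 0 a) + form2 (rchristoffel a) V W).

Lemma nablaE V W a :
  nabla V W 0 a = along d V (W 0 a) + form2 (rchristoffel a) V W.
Proof. by rewrite mxE. Qed.

Lemma nabla_lin1 x V W Z : nabla (x *: V + W) Z = x *: nabla V Z + nabla W Z.
Proof.
by apply/rowP => a; rewrite !(rowE, nablaE) along_lin form2_lin1; ring.
Qed.

Lemma nablaD2 V W Z : nabla V (W + Z) = nabla V W + nabla V Z.
Proof.
apply/rowP => a; rewrite !(rowE, nablaE) alongD form2D2.
by ring.
Qed.

Lemma nabla02 V : nabla V 0 = 0.
Proof. by apply: (addrI (nabla V 0)); rewrite -nablaD2 !addr0. Qed.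

Lemma nablaZ2 x V W : nabla V (x *: W) = x *: nabla V W + along d V x *: W.
Proof.
apply/rowP => a; rewrite !(rowE, nablaE) alongM form2Z2.
by ring.
Qed.

Lemma nablaD1 V W Z : nabla (V + W) Z = nabla V Z + nabla W Z.
Proof. by rewrite -{1}[V]scale1r nabla_lin1 scale1r. Qed.

Lemma nabla01 Z : nabla 0 Z = 0.
Proof. by apply: (addrI (nabla 0 Z)); rewrite -nablaD1 !addr0. Qed.

Lemma nablaZ1 x V Z : nabla (x *: V) Z = x *: nabla V Z.
Proof. by rewrite -[x *: V]addr0 nabla_lin1 nabla01 addr0. Qed.

Lemma nablaN1 V Z : nabla (- V) Z = - nabla V Z.
Proof. by rewrite -!scaleN1r nablaZ1. Qed.

Lemma nablaN2 V Z : nabla V (- Z) = - nabla V Z.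
Proof. by apply: (addrI (nabla V Z)); rewrite -nablaD2 !addrN nabla02. Qed.

Lemma nabla_delta b c :
  nabla (delta_mx 0 b) (delta_mx 0 c) = \row_a rchristoffel a b c.
Proof.
apply/rowP => a; rewrite nablaE along_delta cderiv_delta add0r form2_delta.
by rewrite mxE.
Qed.

Lemma nabla_torsion V W : nabla V W - nabla W V = lie d V W.
Proof.
apply/rowP => a; rewrite !(rowE, nablaE) lieE.
rewrite (_ : form2 (rchristoffel a) W V = form2 (rchristoffel a) V W);
  first by ring.
rewrite /form2 exchange_big; apply: eq_bigr => b _.
by apply: eq_bigr => c _; rewrite chrC; ring.
Qed.

(** The defect [F] is tensorial, so coordinate fields suffice; there the two lowered Christoffel
    symbols add up to twice [rhalf] times the derivative of the metric. *)
Lemma nabla_metric X V W :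
  along d X (rdot V W) = rdot (nabla X V) W + rdot V (nabla X W).
Proof.
pose F X V W := along d X (rdot V W) - rdot (nabla X V) W - rdot V (nabla X W).
suff: F X V W = 0 by move=> H; apply/eqP; rewrite -subr_eq0 opprD addrA -H.
rewrite (@form3E _ _ F); first last.
- by move=> x Y Z V1 V2; rewrite /F !(nablaD2, nablaZ2, dotD2, dotZ2);
    rewrite !(alongD, alongM); ring.
- by move=> x Y Z V1 V2; rewrite /F !(nablaD2, nablaZ2, dotD1, dotZ1);
    rewrite !(alongD, alongM); ring.
- by move=> x Y Z V1 V2;
    rewrite /F along_lin !nabla_lin1 !(dotD1, dotZ1, dotD2, dotZ2); ring.
rewrite /form3 big1 // => a _; rewrite big1 // => b _; rewrite big1 // => c _.
suff -> : F (delta_mx 0 a) (delta_mx 0 b) (delta_mx 0 c) = 0 by ring.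
have H e f h : rdot (delta_mx 0 e) (nabla (delta_mx 0 f) (delta_mx 0 h)) =
    rhalf * (d f (gmx g e h) + d h (gmx g e f) - d e (gmx g f h)).
  rewrite nabla_delta -lower_chr /rdot /form2 exchange_big /=.
  apply: eq_bigr => i _; under eq_bigr do rewrite mulrAC.
  by rewrite sum_delta_mx mxE.
rewrite /F [rdot (nabla _ _) _]dotC !H /rdot form2_delta along_delta.
rewrite (gmxC c a) (gmxC b a) (gmxC c b).
rewrite (_ : _ - _ - _ = (1 - 2%:R * rhalf) * d a (gmx g b c)); first by
  rewrite halfE subrr mul0r.
by ring.
Qed.

Definition curv X Y Z : 'rV[A]_n :=
  nabla X (nabla Y Z) - nabla Y (nabla X Z) - nabla (lie d X Y) Z.

Lemma curvC X Y Z : curv Y X Z = - curv X Y Z.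
Proof.
rewrite /curv lieC nablaN1; apply/rowP => a; rewrite !rowE; ring.
Qed.

Lemma curv_lin1 x V W Y Z :
  curv (x *: V + W) Y Z = x *: curv V Y Z + curv W Y Z.
Proof.
rewrite /curv lie_lin1 !(nablaD1, nablaN1, nablaZ1, nablaD2, nablaZ2).
by apply/rowP => a; rewrite !rowE; ring.
Qed.

Lemma curv_lin2 x V W Y Z :
  curv Y (x *: V + W) Z = x *: curv Y V Z + curv Y W Z.
Proof.
by rewrite !(curvC _ Y) curv_lin1; apply/rowP => a; rewrite !rowE; ring.
Qed.

Lemma curv_lin3 x V W X Y :
  curv X Y (x *: V + W) = x *: curv X Y V + curv X Y W.
Proof.
rewrite /curv !(nablaD2, nablaZ2, nablaD1) along_lie.
by apply/rowP => a; rewrite !rowE; ring.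
Qed.

(** Vanishing torsion turns the cyclic sum of second derivatives into the cyclic sum of double
    brackets, which is zero by Jacobi. *)
Lemma curv_bianchi1 X Y Z : curv X Y Z + curv Y Z X + curv Z X Y = 0.
Proof.
have E U V W : nabla U (nabla V W) - nabla U (nabla W V) - nabla (lie d V W) U
    = - lie d (lie d V W) U.
  by rewrite -nablaN2 -nablaD2 !nabla_torsion; apply: lieC.
have := lie_jacobi d X Y Z => /(congr1 -%R); rewrite oppr0 !opprD -!E => <-.
by rewrite /curv; apply/rowP => a; rewrite !rowE; ring.
Qed.

(** The curvature operator is taken along the last two slots and acts on the second, matching the
    index order of [riemann]. *)
Definition riem_form V1 V2 V3 V4 : A := rdot V1 (curv V3 V4 V2).

Lemma rm_antisym34 V1 V2 V3 V4 :
  riem_form V1 V2 V4 V3 = - riem_form V1 V2 V3 V4.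
Proof. by rewrite /riem_form curvC dotN2. Qed.

(** The commutator of derivatives, applied to the function [rdot V1 V2] and expanded twice by metric
    compatibility, leaves the sum of the two curvature terms. *)
Lemma rm_antisym12 V1 V2 V3 V4 :
  riem_form V2 V1 V3 V4 = - riem_form V1 V2 V3 V4.
Proof.
apply/eqP; rewrite -subr_eq0 opprK; apply/eqP.
have := along_lie d V3 V4 (rdot V1 V2).
rewrite !nabla_metric !alongD !nabla_metric => /eqP; rewrite -subr_eq0 => /eqP.
rewrite /riem_form /curv !dotB2 (dotC V2 (nabla _ (nabla V4 V1))).
rewrite (dotC V2 (nabla V4 (nabla V3 V1))) (dotC V2 (nabla (lie d _ _) V1)).
by move=> H; rewrite -[RHS]oppr0 -H; ring.
Qed.

Lemma rm_bianchi1 V1 V2 V3 V4 :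
  riem_form V1 V2 V3 V4 + riem_form V1 V3 V4 V2 + riem_form V1 V4 V2 V3 = 0.
Proof.
have := curv_bianchi1 V3 V4 V2; rewrite /riem_form -!dotD2 => H.
by rewrite -[RHS](dot02 V1) -H; congr rdot; rewrite addrAC addrC addrA addrAC.
Qed.

(** Pair symmetry follows from four first Bianchi identities: after normalising by [S], their
    alternating sum is twice the difference of the two sides. *)
Lemma rm_pair V1 V2 V3 V4 : riem_form V3 V4 V1 V2 = riem_form V1 V2 V3 V4.
Proof.
have S a b c e : riem_form b a e c = riem_form a b c e.
  by rewrite rm_antisym12 rm_antisym34 opprK.
have B1 := rm_bianchi1 V1 V2 V3 V4.
have B2 := rm_bianchi1 V2 V1 V4 V3.
have B3 := rm_bianchi1 V3 V4 V1 V2.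
have B4 := rm_bianchi1 V4 V3 V2 V1.
rewrite (S V1 V2) (S V4 V2 V1 V3) in B2.
rewrite (S V1 V3 V4 V2) (S V2 V3 V1 V4) in B3.
rewrite (S V3 V4) (S V1 V4 V2 V3) in B4.
apply: mul2I; apply: subr0_eq.
have := congr2 (fun x y => x - y) (congr2 +%R B3 B4) (congr2 +%R B1 B2).
by rewrite !addr0 subrr => <-; ring.
Qed.

(* The commutator form of the second Bianchi identity is the Jacobi identity
   for the operators [nabla X], [nabla Y], [nabla Z]. *)
Lemma rm_bianchi2 X Y Z V W :
  (along d X (riem_form V W Y Z) - riem_form (nabla X V) W Y Z
     - riem_form V (nabla X W) Y Z - riem_form V W (lie d X Y) Z)
  + (along d Y (riem_form V W Z X) - riem_form (nabla Y V) W Z X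
     - riem_form V (nabla Y W) Z X - riem_form V W (lie d Y Z) X)
  + (along d Z (riem_form V W X Y) - riem_form (nabla Z V) W X Y
     - riem_form V (nabla Z W) X Y - riem_form V W (lie d Z X) Y) = 0.
Proof.
rewrite /riem_form !nabla_metric.
have E (a b c e : A) : a + b - a - c - e = b - c - e by ring.
rewrite !E -!dotB2 -!dotD2 -[RHS](dot02 V); congr rdot.
rewrite /curv !(nablaD2, nablaN2).
have J : nabla (lie d (lie d X Y) Z) W + nabla (lie d (lie d Y Z) X) W +
    nabla (lie d (lie d Z X) Y) W = 0.
  by rewrite -!nablaD1 lie_jacobi nabla01.
by rewrite -[RHS]J; apply/rowP => a; rewrite !rowE; ring.
Qed.

Definition rriemann_up a b c e : A :=
  d c (rchristoffel a e b) - d e (rchristoffel a c b)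
  + \sum_f (rchristoffel a c f * rchristoffel f e b - rchristoffel a e f *
    rchristoffel f c b).

Lemma curv_delta b c e : curv (delta_mx 0 c) (delta_mx 0 e) (delta_mx 0 b) =
  \row_a rriemann_up a b c e.
Proof.
have L : lie d (delta_mx 0 c) (delta_mx 0 e) = 0.
  by apply/rowP => a; rewrite lieE !along_delta !cderiv_delta subrr mxE.
have F a i v : form2 (rchristoffel a) (delta_mx 0 i) (\row_k v k) =
    \sum_k rchristoffel a i k * v k.
  rewrite /form2 exchange_big; apply: eq_bigr => k _ /=.
  by under eq_bigr do rewrite mulrAC; rewrite sum_delta_mx mxE.
apply/rowP => a; rewrite /curv L nabla01 subr0 !nabla_delta !rowE !nablaE !F.
by rewrite !along_delta !mxE /rriemann_up sumrB; ring.
Qed.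

Definition rriemann a b c e : A := \sum_f gmx g a f * rriemann_up f b c e.

Lemma rm_lin1 x V W V2 V3 V4 :
  riem_form (x *: V + W) V2 V3 V4 = x * riem_form V V2 V3 V4 + riem_form W V2
    V3 V4.
Proof. exact: dot_lin1. Qed.
Lemma rm_lin2 x V W V1 V3 V4 :
  riem_form V1 (x *: V + W) V3 V4 = x * riem_form V1 V V3 V4 + riem_form V1 W
    V3 V4.
Proof. by rewrite /riem_form curv_lin3 dot_lin2. Qed.
Lemma rm_lin3 x V W V1 V2 V4 :
  riem_form V1 V2 (x *: V + W) V4 = x * riem_form V1 V2 V V4 + riem_form V1 V2
    W V4.
Proof. by rewrite /riem_form curv_lin1 dot_lin2. Qed.
Lemma rm_lin4 x V W V1 V2 V3 :
  riem_form V1 V2 V3 (x *: V + W) = x * riem_form V1 V2 V3 V + riem_form V1 V2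
    V3 W.
Proof. by rewrite /riem_form curv_lin2 dot_lin2. Qed.

Lemma rm_delta a b c e :
  riem_form (delta_mx 0 a) (delta_mx 0 b) (delta_mx 0 c)
    (delta_mx 0 e) = rriemann a b c e.
Proof.
rewrite /riem_form curv_delta /rdot /form2 exchange_big;
  apply: eq_bigr => f _ /=.
by under eq_bigr do rewrite mulrAC; rewrite sum_delta_mx mxE.
Qed.

Definition nabla2 (T : 'I_n -> 'I_n -> A) a b c : A :=
  d a (T b c) - \sum_e (rchristoffel e a b * T e c + rchristoffel e a c * T b
    e).

Lemma nabla2E T X V W : form3 (nabla2 T) X V W =
  along d X (form2 T V W) - form2 T (nabla X V) W - form2 T V (nabla X W).
Proof.
pose F X V W :=
  along d X (form2 T V W) - form2 T (nabla X V) W - form2 T V (nabla X W).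
rewrite -/(F X V W) (@form3E _ _ F); first last.
- by move=> x Y Z V1 V2; rewrite /F !(nablaD2, nablaZ2, form2D2, form2Z2);
    rewrite !(alongD, alongM); ring.
- by move=> x Y Z V1 V2; rewrite /F !(nablaD2, nablaZ2, form2D1, form2Z1);
    rewrite !(alongD, alongM); ring.
- by move=> x Y Z V1 V2;
    rewrite /F along_lin !nabla_lin1 !(form2_lin1, form2_lin2); ring.
apply: eq_bigr => a _; apply: eq_bigr => b _; apply: eq_bigr => c _.
do 3 congr (_ * _).
rewrite /F form2_delta along_delta /nabla2 big_split /= opprD addrA.
congr (_ - _ - _).
  rewrite nabla_delta /form2; apply: eq_bigr => e _.
  by rewrite sum_delta_mx mxE mulrC.
rewrite nabla_delta /form2 exchange_big /=; apply: eq_bigr => e _ /=.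
by under eq_bigr do rewrite mulrAC; rewrite sum_delta_mx mxE mulrC.
Qed.

End LeviCivita.

(** * Tensors with the symmetries of the Weyl tensor in a null frame *)

Section NullFrame.
Variables (K : comPzRingType) (G Gi : 'M[K]_4).
Hypotheses (Gsym : G^T = G) (GiG : Gi *m G = 1%:M).
Implicit Types V W : 'rV[K]_4.
Local Notation dot := (form2 G).

(** The counterpart over a ring of [null_frame], used both for frame fields and for frames at a
    point. *)
Record is_null_frame (m p n k : 'rV[K]_4) : Prop := IsNullFrame {
  null_mp : dot m p = 1; null_nk : dot n k = 1;
  null_mm : dot m m = 0; null_pp : dot p p = 0;
  null_nn : dot n n = 0; null_kk : dot k k = 0;
  null_mn : dot m n = 0; null_mk : dot m k = 0;
  null_pn : dot p n = 0; null_pk : dot p k = 0 }.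

Lemma form2_sym V W : dot V W = dot W V.
Proof.
rewrite /form2 exchange_big; apply: eq_bigr => a _; apply: eq_bigr => b _.
by rewrite -{1}Gsym mxE; ring.
Qed.

Lemma form2_mx V W : dot V W = (V *m G *m W^T) 0 0.
Proof.
rewrite /form2 exchange_big mxE; apply: eq_bigr => a _.
by rewrite !mxE mulr_suml; apply: eq_bigr => b _; ring.
Qed.

Variables m p n k : 'rV[K]_4.
Hypothesis fr : is_null_frame m p n k.

Lemma null_frame_sym : [/\ dot p m = 1, dot k n = 1,
  dot n m = 0 /\ dot k m = 0 & dot n p = 0 /\ dot k p = 0].
Proof. by case: fr => *; do !split; rewrite form2_sym. Qed.

(** One rewriting bundle for all sixteen products of frame vectors. *)
Definition null_dotE := (null_mp fr, null_nk fr, null_mm fr, null_pp fr,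
  null_nn fr, null_kk fr, null_mn fr, null_mk fr, null_pn fr, null_pk fr,
  let: And4 a _ _ _ := null_frame_sym in a,
  let: And4 _ a _ _ := null_frame_sym in a,
  let: And4 _ _ (conj a _) _ := null_frame_sym in a,
  let: And4 _ _ (conj _ a) _ := null_frame_sym in a,
  let: And4 _ _ _ (conj a _) := null_frame_sym in a,
  let: And4 _ _ _ (conj _ a) := null_frame_sym in a).

(** The rows of [E'] form the frame dual to [E], so [E *m G *m E'^T] is the identity. Square
    matrices commute with their inverses, hence [Gi] is [E'^T *m E]. *)
Lemma null_frame_inv a b :
  Gi a b = m 0 a * p 0 b + p 0 a * m 0 b + n 0 a * k 0 b + k 0 a * n 0 b.
Proof.
pose e (i : 'I_4) : 'rV[K]_4 := nth 0 [:: m; p; n; k] i.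
pose e' (i : 'I_4) : 'rV[K]_4 := nth 0 [:: p; m; k; n] i.
pose E : 'M[K]_4 := \matrix_(i, j) e i 0 j.
pose E' : 'M[K]_4 := \matrix_(i, j) e' i 0 j.
have E1 : E *m (G *m E'^T) = 1%:M.
  apply/matrixP => i j; have -> : (E *m (G *m E'^T)) i j = dot (e i) (e' j).
    rewrite mulmxA form2_mx !mxE; apply: eq_bigr => l _; rewrite !mxE.
    by congr (_ * _); apply: eq_bigr => q _; rewrite mxE.
  rewrite mxE -val_eqE /e /e'.
  by case: i j => [[|[|[|[|?]]]] ?] [[|[|[|[|?]]]] ?] //=; rewrite null_dotE.
have := congr1 (fun M => Gi *m M) (mulmx1C E1).
rewrite /= mulmx1 -mulmxA mulmxA GiG mul1mx => <-.
rewrite mxE !big_ord_recl big_ord0 !mxE /e /e' /=.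
by ring.
Qed.

Lemma null_frame_decomp V :
  V = dot V p *: m + dot V m *: p + dot V k *: n + dot V n *: k.
Proof.
have E (v w : 'rV[K]_4) a : dot V v * w 0 a =
    \sum_b (V *m G) 0 b * (v 0 b * w 0 a).
  by rewrite form2_mx mxE mulr_suml; apply: eq_bigr => b _; rewrite !mxE mulrA.
apply/rowP => a; rewrite !rowE !E -!big_split /=.
have /rowP/(_ a) : V *m G *m Gi = V by rewrite -mulmxA (mulmx1C GiG) mulmx1.
rewrite mxE => <-; apply: eq_bigr => b _; rewrite null_frame_inv; ring.
Qed.

Lemma null_frame_dot V W : dot V W =
  dot V p * dot W m + dot V m * dot W p + dot V k * dot W n + dot V n * dot W k.
Proof.
rewrite {1}[V]null_frame_decomp !form2D1 !form2Z1.
by rewrite !(form2_sym _ W).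
Qed.

End NullFrame.

(* The value on [V1 .. V4] of a tensor [F] with the algebraic symmetries of the
   Weyl tensor, from its ten independent components in a null frame. *)
Definition weyl_expansion (K : comPzRingType) (G : 'M[K]_4)
    (F : 'rV[K]_4 -> 'rV[K]_4 -> 'rV[K]_4 -> 'rV[K]_4 -> K)
    (m p n k V1 V2 V3 V4 : 'rV[K]_4) : K :=
  let a e e' := form2 G V1 e * form2 G V2 e' - form2 G V1 e' * form2 G V2 e in
  let b e e' := form2 G V3 e * form2 G V4 e' - form2 G V3 e' * form2 G V4 e in
  F m k m k * a p n * b p n
  + F m k n k * (a p n * (b k n - b p m) + (a k n - a p m) * b p n)
  + F m k p n * (a p n * b m k + a m k * b p n
                 + (a p m - a k n) * (b p m - b k n))
  + F p n m p * (a m k * (b p m - b k n) + (a p m - a k n) * b m k)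
  + F p n p n * a m k * b m k
  + F m n p k * (a p k * b m n + a m n * b p k
                 + (a p m + a k n) * (b p m + b k n))
  + F m n m n * a p k * b p k
  + F p k p k * a m n * b m n
  + F m n n k * (a p k * (b p m + b k n) + (a p m + a k n) * b p k)
  + F p k n k * (a m n * (b p m + b k n) + (a p m + a k n) * b m n).

Section WeylTensor.
Variables (K : comPzRingType) (Gi : 'M[K]_4) (h : K).
Hypothesis hE : 2%:R * h = 1.
Variable T : 'I_4 -> 'I_4 -> 'I_4 -> 'I_4 -> K.

Lemma double_eq0 (x : K) : x + x = 0 -> x = 0.
Proof.
move=> x0; have -> : x = h * (x + x) + (1 - 2%:R * h) * x by ring.
by rewrite x0 hE subrr mulr0 mul0r addr0.
Qed.

Record is_weyl_tensor : Prop := IsWeylTensor {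
  weylT_antisym : forall a b c e, T b a c e = - T a b c e;
  weylT_pair : forall a b c e, T c e a b = T a b c e;
  weylT_bianchi : forall a b c e, T a b c e + T a c e b + T a e b c = 0;
  weylT_trace : forall b e, \sum_a \sum_c Gi a c * T a b c e = 0 }.

Hypothesis TW : is_weyl_tensor.
Local Notation F := (form4 T).

Lemma weylF_antisym12 V1 V2 V3 V4 : F V2 V1 V3 V4 = - F V1 V2 V3 V4.
Proof.
rewrite /form4 exchange_big /= -sumrN; apply: eq_bigr => a _.
rewrite -sumrN; apply: eq_bigr => b _; rewrite -sumrN; apply: eq_bigr => c _.
rewrite -sumrN; apply: eq_bigr => e _; rewrite (weylT_antisym TW); ring.
Qed.

Lemma weylF_pair V1 V2 V3 V4 : F V3 V4 V1 V2 = F V1 V2 V3 V4.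
Proof.
rewrite /form4; under eq_bigr do rewrite exchange_big.
rewrite exchange_big; apply: eq_bigr => a _.
under eq_bigr do rewrite exchange_big.
rewrite exchange_big; apply: eq_bigr => b _.
apply: eq_bigr => c _; apply: eq_bigr => e _.
by rewrite (weylT_pair TW); ring.
Qed.

Lemma weylF_antisym34 V1 V2 V3 V4 : F V1 V2 V4 V3 = - F V1 V2 V3 V4.
Proof. by rewrite weylF_pair weylF_antisym12 weylF_pair. Qed.

Lemma weylF_bianchi V1 V2 V3 V4 :
  F V1 V2 V3 V4 + F V1 V3 V4 V2 + F V1 V4 V2 V3 = 0.
Proof.
rewrite /form4 -!big_split big1 // => a _ /=.
have -> : \sum_i \sum_j \sum_l T a i j l * V1 0 a * V3 0 i * V4 0 j * V2 0 l =
    \sum_b \sum_c \sum_e T a c e b * V1 0 a * V2 0 b * V3 0 c * V4 0 e.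
  under eq_bigr do rewrite exchange_big.
  rewrite exchange_big; do 3!(apply: eq_bigr => ? _); ring.
have -> : \sum_i \sum_j \sum_l T a i j l * V1 0 a * V4 0 i * V2 0 j * V3 0 l =
    \sum_b \sum_c \sum_e T a e b c * V1 0 a * V2 0 b * V3 0 c * V4 0 e.
  rewrite exchange_big; apply: eq_bigr => ? _.
  by rewrite exchange_big; do 2!(apply: eq_bigr => ? _); ring.
rewrite -!big_split big1 // => b _ /=; rewrite -!big_split big1 // => c _ /=.
rewrite -!big_split big1 // => e _ /=.
rewrite (_ : _ + _ = (T a b c e + T a c e b + T a e b c) *
  (V1 0 a * V2 0 b * V3 0 c * V4 0 e)); last by ring.
by rewrite (weylT_bianchi TW) mul0r.
Qed.

Variables (G : 'M[K]_4) (m p n k : 'rV[K]_4).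
Hypotheses (Gsym : G^T = G) (GiG : Gi *m G = 1%:M).
Hypothesis fr : is_null_frame G m p n k.
Local Notation dot := (form2 G).

(** The contraction with the inverse metric, rewritten through the frame expression of that
    inverse. *)
Lemma weylF_trace V W : F m V p W + F p V m W + F n V k W + F k V n W = 0.
Proof.
have E (v w : 'rV[K]_4) : F v V w W =
    \sum_b \sum_e (\sum_a \sum_c T a b c e * (v 0 a * w 0 c)) * (V 0 b * W 0 e).
  rewrite /form4 exchange_big; apply: eq_bigr => b _ /=.
  under eq_bigr do rewrite exchange_big.
  rewrite exchange_big; apply: eq_bigr => e _ /=.
  rewrite mulr_suml; apply: eq_bigr => a _; rewrite mulr_suml.
  by apply: eq_bigr => c _; ring.
rewrite !E -!big_split big1 // => b _ /=; rewrite -!big_split big1 // => e _ /=.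
rewrite -!mulrDl -!big_split /= (_ : \sum_a _ = 0) ?mul0r //.
rewrite -[RHS](weylT_trace TW b e); apply: eq_bigr => a _ /=.
rewrite -!big_split; apply: eq_bigr => c _ /=.
by rewrite (null_frame_inv Gsym GiG fr); ring.
Qed.

(** Expansion over the six frame bivectors. Each coefficient pairs with the dual bivector: [m] is
    read off by a product with [p], and [n] by one with [k]. *)
Lemma antisym_frame (B : 'rV[K]_4 -> 'rV[K]_4 -> K) :
  (forall x V W V2, B (x *: V + W) V2 = x * B V V2 + B W V2) ->
  (forall x V W V1, B V1 (x *: V + W) = x * B V1 V + B V1 W) ->
  (forall V W, B W V = - B V W) ->
  forall V W,
  let w e e' := dot V e * dot W e' - dot V e' * dot W e in
  B V W = w p m * B m p + w k n * B n k + w p n * B m k + w m k * B p n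
        + w p k * B m n + w m n * B p k.
Proof.
move=> B1 B2 Ba V W w.
have B0 X : B X X = 0.
  by apply: double_eq0; rewrite {1}Ba addNr.
have -> : B V W = B (dot V p *: m + dot V m *: p + dot V k *: n + dot V n *: k)
    (dot W p *: m + dot W m *: p + dot W k *: n + dot W n *: k).
  by rewrite -!(null_frame_decomp Gsym GiG fr).
rewrite (lin_sum4 (F := B^~ _)); last by move=> *; apply: B1.
rewrite !(lin_sum4 (F := B _)); try by move=> *; apply: B2.
rewrite !B0 (Ba m p) (Ba m n) (Ba m k) (Ba p n) (Ba p k) (Ba n k) /w.
by ring.
Qed.

Local Notation P0 := (F m k m k).
Local Notation P1 := (F m k n k).
Local Notation P2 := (F m k p n).
Local Notation P3 := (F p n m p).
Local Notation P4 := (F p n p n).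

(** A symmetric form on six bivectors has 21 components; the Bianchi identity and ten traces
    eliminate 11. The remaining ten are the five [Psi] of the selfdual part and five of the
    antiselfdual part. *)
Lemma weyl_frame V1 V2 V3 V4 :
  F V1 V2 V3 V4 = weyl_expansion G F m p n k V1 V2 V3 V4.
Proof.
pose a e e' := dot V1 e * dot V2 e' - dot V1 e' * dot V2 e.
pose b e e' := dot V3 e * dot V4 e' - dot V3 e' * dot V4 e.
rewrite /weyl_expansion -/a -/b.
have S := weylF_antisym34; have A := weylF_antisym12; have Pr := weylF_pair.
have mm := weylF_trace m m; have kk := weylF_trace k k.
have pp := weylF_trace p p; have nn := weylF_trace n n.
have mk := weylF_trace m k; have mn := weylF_trace m n.
have pk := weylF_trace p k; have pn := weylF_trace p n.
have mp := weylF_trace m p; have nk := weylF_trace n k.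
have bi := weylF_bianchi m p n k.
have Z V U W : F V V U W = 0 by apply: double_eq0; rewrite {1}A addNr.
have Z' V U W : F U W V V = 0 by rewrite -Pr Z.
(* These rules bring every component to a fixed order inside each pair and between the two pairs, so
   that the relations below become linear in 21 atoms. *)
have N := (Z, Z', A m p, A m k, A m n, A p n, A p k, A n k,
  fun V W => S V W m p, fun V W => S V W m k, fun V W => S V W m n,
  fun V W => S V W p n, fun V W => S V W p k, fun V W => S V W n k,
  Pr m p m k, Pr m k p n, Pr m k n k, Pr m k m n, Pr m k p k,
  Pr m p p n, Pr n k p n, Pr m n p n, Pr p k p n, Pr m p n k, Pr m p m n,
  Pr n k m n, Pr m p p k, Pr n k p k, Pr m n p k).
rewrite !N in mm kk pp nn mk mn pk pn mp nk bi *.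
(* Each of [e1] to [e11] solves one trace, or the Bianchi identity [bi], for one of the dependent
   components. *)
have e1 : F m k m n = 0 by apply: double_eq0; rewrite -[RHS]mm; ring.
have e2 : F m k p k = 0 by apply: double_eq0; rewrite -[RHS]kk; ring.
have e3 : F p k p n = 0 by apply: double_eq0; rewrite -[RHS]pp; ring.
have e4 : F m n p n = 0 by apply: double_eq0; rewrite -[RHS]nn; ring.
have solve (x y z : K) : z = 0 -> x - y = - z -> x = y.
  by move=> -> /eqP; rewrite oppr0 subr_eq0 => /eqP.
have e5 : F m p m k = - P1 by apply: (solve _ _ _ mk); ring.
have e6 : F m p m n = F n k m n by apply: (solve _ _ _ mn); ring.
have e7 : F m p p k = F n k p k by apply: subr0_eq; rewrite -[RHS]pk; ring.
have e8 : F n k p n = - F m p p n by apply: subr0_eq; rewrite -[RHS]pn; ring.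
have e9 : F m p m p = F m n p k + P2 by apply: (solve _ _ _ mp); ring.
have e10 : F n k n k = F m n p k + P2 by apply: (solve _ _ _ nk); ring.
have e11 : F m p n k = F m n p k - P2 by apply: subr0_eq; rewrite -[RHS]bi;
  ring.
have D V W : F V W V3 V4 = b p m * F V W m p + b k n * F V W n k
    + b p n * F V W m k + b m k * F V W p n
    + b p k * F V W m n + b m n * F V W p k.
  apply: (antisym_frame (B := F V W)).
  - by move=> *; apply: form4_lin3.
  - by move=> *; apply: form4_lin4.
  - by move=> *; apply: weylF_antisym34.
rewrite (@antisym_frame (fun V W => F V W V3 V4)); first last.
- by move=> V W; apply: weylF_antisym12.
- by move=> *; apply: form4_lin2.
- by move=> *; apply: form4_lin1.
rewrite -!/(a _ _) !D !N e1 e2 e3 e4 e5 e6 e7 e8 e9 e10 e11.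
rewrite /a /b; ring.
Qed.

End WeylTensor.

(** * Weyl and Cotton tensors *)

Section Weyl.
Variables (A : comPzRingType) (d : commuting_derivations A 4) (g :
  ring_metric A 4).
Implicit Types (x y z : A) (V W X Y Z : 'rV[A]_4).
Local Notation G := (gmx g).
Local Notation Gi := (ginv g).
Local Notation t := (twelfth g).
Local Notation rriemann := (rriemann d g).
Local Notation rm := (riem_form d g).
Local Notation nab := (nabla d g).
Local Notation half := (rhalf g).

Definition rricci a b : A := \sum_c rriemann_up d g c a c b.
Definition rscalar : A := \sum_a \sum_b Gi a b * rricci a b.
Definition rschouten a b : A := half * rricci a b - t * rscalar * G a b.
Definition rweyl a b c e : A :=
  rriemann a b c e + G a e * rschouten c b - G a c * rschouten e b
  + G b c * rschouten e a - G b e * rschouten c a.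
Definition rcotton a b c : A :=
  nabla2 d g rschouten b c a - nabla2 d g rschouten c b a.

Local Notation P := (form2 rschouten).
Local Notation F := (form4 rweyl).

Lemma ginvC a b : Gi a b = Gi b a.
Proof.
suff E : (ginv g)^T = ginv g by rewrite -{1}E mxE.
rewrite -[LHS]mulmx1 -(gmxVr g) mulmxA.
by rewrite -{1}(gmx_sym g) -trmx_mul gmxVr trmx1 mul1mx.
Qed.

Lemma sum_ginvM a b : \sum_c Gi a c * G c b = (a == b)%:R.
Proof. by have := congr1 (fun M : 'M[A]_4 => M a b) (gmxV g); rewrite !mxE. Qed.

Lemma sum_eq (f : 'I_4 -> A) a : \sum_b (a == b)%:R * f b = f a.
Proof.
rewrite (bigD1 a) //= eqxx mul1r big1 ?addr0 // => b /negPf.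
by rewrite eq_sym => ->; rewrite mul0r.
Qed.

Lemma sum_ginv_riem b e : \sum_a \sum_c Gi a c * rriemann a b c e = rricci b e.
Proof.
rewrite exchange_big; apply: eq_bigr => c _ /=; rewrite /rriemann.
under eq_bigr do rewrite ginvC mulr_sumr; rewrite exchange_big /=.
under eq_bigr do (under eq_bigr do rewrite mulrA; rewrite -mulr_suml sum_ginvM).
by rewrite sum_eq.
Qed.

Lemma riemC a b c e : [/\ rriemann b a c e = - rriemann a b c e,
  rriemann a b e c = - rriemann a b c e, rriemann c e a b = rriemann a b c e &
  rriemann a b c e + rriemann a c e b + rriemann a e b c = 0].
Proof.
by rewrite -!rm_delta; split; [apply: rm_antisym12|apply: rm_antisym34|
  apply: rm_pair|apply: rm_bianchi1].
Qed.

Lemma ricC a b : rricci a b = rricci b a.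
Proof.
rewrite -!sum_ginv_riem exchange_big; apply: eq_bigr => c _ /=.
apply: eq_bigr => e _; rewrite ginvC; congr (_ * _).
by case: (riemC c b e a).
Qed.

Lemma schC a b : rschouten a b = rschouten b a.
Proof. by rewrite /rschouten ricC gmxC. Qed.

Lemma sch_formC V W : P V W = P W V.
Proof.
rewrite /form2 exchange_big; apply: eq_bigr => a _; apply: eq_bigr => b _.
by rewrite schC; ring.
Qed.

(** The trace equals [Ric - 2 P - (tr P) g], where the dimension four enters through the trace of
    [g]; the constants in the Schouten tensor [P] are those that make this vanish. *)
Lemma weyl_trace b e : \sum_a \sum_c Gi a c * rweyl a b c e = 0.
Proof.
have H f : \sum_a \sum_c Gi a c * (G a e * f c) = f e.
  rewrite exchange_big /= -[RHS](sum_eq f); apply: eq_bigr => c _.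
  rewrite eq_sym -sum_ginvM mulr_suml; apply: eq_bigr => a _.
  by rewrite (ginvC a c); ring.
have H' f : \sum_a \sum_c Gi a c * (G b c * f a) = f b.
  rewrite -[RHS](sum_eq f); apply: eq_bigr => a _.
  rewrite eq_sym -sum_ginvM mulr_suml; apply: eq_bigr => c _.
  by rewrite (gmxC g b c); ring.
have E4 : \sum_a \sum_c Gi a c * G a c = 4%:R.
  under eq_bigr do (under eq_bigr do rewrite (gmxC g); rewrite sum_ginvM eqxx).
  by rewrite sumr_const card_ord.
have E5 : \sum_a \sum_c Gi a c * rschouten c a = half * rscalar - t * rscalar
  * 4%:R.
  rewrite -E4 /rschouten; move: (t * rscalar) => u; rewrite /rscalar.
  rewrite !mulr_sumr -sumrB; apply: eq_bigr => a _.
  by rewrite !mulr_sumr -sumrB; apply: eq_bigr => c _; rewrite ricC gmxC; ring.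
transitivity (\sum_a \sum_c Gi a c * rriemann a b c e +
  \sum_a \sum_c Gi a c * (G a e * rschouten c b) -
  (\sum_a \sum_c Gi a c * G a c) * rschouten e b +
  \sum_a \sum_c Gi a c * (G b c * rschouten e a) -
  G b e * \sum_a \sum_c Gi a c * rschouten c a).
  rewrite mulr_suml mulr_sumr -big_split -sumrB -big_split -sumrB.
  apply: eq_bigr => a _; rewrite mulr_suml mulr_sumr.
  rewrite -big_split -sumrB -big_split -sumrB.
  by apply: eq_bigr => c _; rewrite /rweyl /=; ring.
rewrite sum_ginv_riem (H (rschouten^~ b))
  (H' (rschouten e)) E4 E5 (schC e b) /rschouten.
rewrite (_ : _ - _ = (1 - 12%:R * t) * rricci b e); last first.
  by rewrite /half; ring.
by rewrite twelfthE subrr mul0r.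
Qed.

Lemma wl_weyl_tensor : is_weyl_tensor Gi rweyl.
Proof.
split=> [a b c e|a b c e|a b c e|]; last exact: weyl_trace.
- by rewrite /rweyl; case: (riemC a b c e) => -> _ _ _; ring.
- rewrite /rweyl; case: (riemC a b c e) => _ _ -> _.
  rewrite (gmxC g c b) (gmxC g e a) (gmxC g c a) (gmxC g e b).
  by rewrite (schC a e) (schC b e) (schC b c) (schC a c); ring.
- rewrite /rweyl (gmxC g c b) (gmxC g e b) (gmxC g e c).
  case: (riemC a b c e) => _ _ _ B.
  rewrite (schC b c) (schC e b) (schC e c).
  by rewrite -[RHS]B; ring.
Qed.

Lemma weylE V1 V2 V3 V4 : F V1 V2 V3 V4 =
  rm V1 V2 V3 V4 + rdot g V1 V4 * P V3 V2 - rdot g V1 V3 * P V4 V2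
  + rdot g V2 V3 * P V4 V1 - rdot g V2 V4 * P V3 V1.
Proof.
rewrite (form4E (F := fun V1 V2 V3 V4 => rm V1 V2 V3 V4
  + rdot g V1 V4 * P V3 V2 - rdot g V1 V3 * P V4 V2
  + rdot g V2 V3 * P V4 V1 - rdot g V2 V4 * P V3 V1)).
- apply: eq_bigr => a _; apply: eq_bigr => b _; apply: eq_bigr => c _.
  apply: eq_bigr => e _.
  by rewrite rm_delta /rdot !form2_delta.
- by move=> *; rewrite rm_lin1 !(dot_lin1, dot_lin2, form2_lin1, form2_lin2);
  ring.
- by move=> *; rewrite rm_lin2 !(dot_lin1, dot_lin2, form2_lin1, form2_lin2);
  ring.
- by move=> *; rewrite rm_lin3 !(dot_lin1, dot_lin2, form2_lin1, form2_lin2);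
  ring.
- by move=> *; rewrite rm_lin4 !(dot_lin1, dot_lin2, form2_lin1, form2_lin2);
  ring.
Qed.

Lemma cotE V X Y : form3 rcotton V X Y =
  (along d X (P Y V) - P (nab X Y) V - P Y (nab X V))
  - (along d Y (P X V) - P (nab Y X) V - P X (nab Y V)).
Proof.
pose T := nabla2 d g rschouten.
have -> : form3 rcotton V X Y = form3 T X Y V - form3 T Y X V.
  transitivity (form3 (fun a b c => T b c a) V X Y
      - form3 (fun a b c => T c b a) V X Y).
    rewrite /form3 -sumrB; apply: eq_bigr => a _; rewrite -sumrB.
    apply: eq_bigr => b _; rewrite -sumrB; apply: eq_bigr => c _.
    by rewrite /rcotton -/T; ring.
  congr (_ - _); rewrite /form3.
    rewrite exchange_big; apply: eq_bigr => a _; rewrite exchange_big.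
    by do 2!(apply: eq_bigr => ? _); ring.
  under eq_bigr do rewrite exchange_big.
  rewrite exchange_big; apply: eq_bigr => a _; rewrite exchange_big.
  by do 2!(apply: eq_bigr => ? _); ring.
by rewrite !nabla2E.
Qed.

(** Splitting the curvature in the second Bianchi identity into Weyl and Schouten parts, the
    derivatives of the Schouten tensor occur antisymmetrised and so assemble into Cotton tensors. *)
Lemma weyl_bianchi2 X Y Z V W :
  (along d X (F V W Y Z) - F (nab X V) W Y Z - F V (nab X W) Y Z
     - F V W (lie d X Y) Z)
  + (along d Y (F V W Z X) - F (nab Y V) W Z X - F V (nab Y W) Z X
     - F V W (lie d Y Z) X)
  + (along d Z (F V W X Y) - F (nab Z V) W X Y - F V (nab Z W) X Y
     - F V W (lie d Z X) Y) =
  rdot g V Z * form3 rcotton W X Y - rdot g W Z * form3 rcotton V X Y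
  + rdot g V X * form3 rcotton W Y Z - rdot g W X * form3 rcotton V Y Z
  + rdot g V Y * form3 rcotton W Z X - rdot g W Y * form3 rcotton V Z X.
Proof.
rewrite !weylE !cotE; have := rm_bianchi2 d g X Y Z V W.
move: (riem_form d g) => R0; rewrite !(alongD, alongN, alongM) !nabla_metric.
have N1 V1 U : P (- V1) U = - P V1 U by rewrite -scaleN1r form2Z1 mulN1r.
rewrite -!(nabla_torsion d g) !(form2D1, dotB2, dotB1) !N1.
(* Once the operators are abstracted, the remaining identity is purely algebraic in their values. *)
move: (P) (rdot g) (along d) (nab) => p0 g0 d0 n0.
move=> B; rewrite -[RHS]add0r -B; ring.
Qed.

End Weyl.

(** * Null frame fields *)

Section FrameField.
Variables (A : comPzRingType) (d : commuting_derivations A 4) (g :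
  ring_metric A 4).
Variables m p n k : 'rV[A]_4.
Hypothesis fr : is_null_frame (gmx g) m p n k.
Implicit Types (x y z : A) (V W X Y Z : 'rV[A]_4).
Local Notation rm := (riem_form d g).
Local Notation nab := (nabla d g).
Local Notation dot := (form2 (gmx g)).
Local Notation F := (form4 (rweyl d g)).
Local Notation C3 := (form3 (rcotton d g)).

Let frE := null_dotE (gmx_sym g) fr.

(** Products of frame vectors are the constants [0] and [1], so metric compatibility makes
    connection coefficients antisymmetric. *)
Lemma along_const X V W i : dot V W = i%:R ->
  dot (nab X W) V = - dot (nab X V) W.
Proof.
rewrite -[dot V W]/(rdot g V W) => c; have := nabla_metric d g X V W.
rewrite c along_nat (dotC g V) => /esym/eqP.
by rewrite addrC addr_eq0 => /eqP.
Qed.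

Lemma nabla_null X V : dot V V = 0 -> dot (nab X V) V = 0.
Proof.
move=> c; apply: (double_eq0 (halfE g)).
by rewrite {1}(@along_const X V V 0) // addNr.
Qed.

(** A rewriting bundle that reduces the connection coefficients in a direction [X] to six
    independent ones, so that [ring] sees no hidden relation. *)
Definition connE X :=
  (nabla_null X (null_mm fr), nabla_null X (null_pp fr),
   nabla_null X (null_nn fr), nabla_null X (null_kk fr),
   @along_const X m p 1%N (null_mp fr), @along_const X m k 0%N (null_mk fr),
   @along_const X m n 0%N (null_mn fr), @along_const X p n 0%N (null_pn fr),
   @along_const X p k 0%N (null_pk fr), @along_const X n k 1%N (null_nk fr)).

Lemma lie_dot X Y V : dot (lie d X Y) V = dot (nab X Y) V - dot (nab Y X) V.
Proof. by rewrite -(nabla_torsion d g) [LHS]dotB1. Qed.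

Lemma nabla_frame V W Z : dot (nab V W) Z =
  dot V p * dot (nab m W) Z + dot V m * dot (nab p W) Z
  + dot V k * dot (nab n W) Z + dot V n * dot (nab k W) Z.
Proof.
rewrite {1}(null_frame_decomp (gmx_sym g) (gmxV g) fr V).
by rewrite !(nablaD1, nablaZ1) !(form2D1, form2Z1).
Qed.

Lemma along_frame V x : along d V x =
  dot V p * along d m x + dot V m * along d p x
  + dot V k * along d n x + dot V n * along d k x.
Proof.
rewrite {1}(null_frame_decomp (gmx_sym g) (gmxV g) fr V).
by rewrite (lin_sum4 (F := along d ^~ x)) // => *; apply: along_lin.
Qed.

(* [tau] is the connection form of the line bundle [N /\ N], and [omega]
   measures its failure to be parallel. *)
Definition tau X := dot (nab X m) p + dot (nab X k) n.
Definition omega X := dot (nab X m) k.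

Local Notation Psi0 := (F m k m k).
Local Notation Psi1 := (F m k n k).
Local Notation Psi2 := (F m k p n).

(** The opaque copy [F'] on the right keeps repeated rewriting with the expansion from applying
    again to its own result. *)
Lemma weyl_frame_once : exists2 F', F' = F & forall V1 V2 V3 V4,
  F V1 V2 V3 V4 = weyl_expansion (gmx g) F' m p n k V1 V2 V3 V4.
Proof.
exists F => // V1 V2 V3 V4.
exact: (weyl_frame (halfE g) (wl_weyl_tensor d g) (gmx_sym g) (gmxV g) fr).
Qed.

(** In this component of the Bianchi identity the derivative along [k] falls on a component killed
    by tracelessness and the one along [n] falls on [Psi0]; only the derivative of [Psi1] along [m]
    survives. *)
Lemma bianchi_m : Psi0 = 0 ->
  along d m Psi1 = (tau m - 4%:R * omega n) * Psi1
    + 3%:R * omega m * Psi2 + C3 m m k.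
Proof.
move=> P0; have := weyl_bianchi2 d g m k n k m.
have [F' FF' E] := weyl_frame_once.
have -> : F k m k n = Psi1.
  by rewrite !E /weyl_expansion !frE; ring.
have -> : F k m n m = 0.
  by rewrite !E /weyl_expansion !frE; ring.
have -> : F k m m k = 0.
  by rewrite -[RHS]oppr0 -P0 !E /weyl_expansion !frE; ring.
have P0' : F' m k m k = 0 by rewrite FF'.
(* The derivative is abstracted first, so that the frame expansion does not rewrite [Psi1] under
   it. *)
rewrite !along0; move: (along d m Psi1) => q.
rewrite !E /weyl_expansion; cbv zeta beta.
rewrite P0' /tau /omega /rdot !lie_dot !frE !connE => H; apply: subr0_eq.
move/eqP: H; rewrite -subr_eq0 => /eqP H; rewrite -[RHS]H; ring.
Qed.

(** The same argument with [p] in place of [n]: now the derivative along [m] falls on a vanishing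
    component, and the one along [k] on [- Psi1]. *)
Lemma bianchi_k : Psi0 = 0 ->
  along d k Psi1 = (tau k + 4%:R * omega p) * Psi1
    + 3%:R * omega k * Psi2 + C3 k m k.
Proof.
move=> P0; have := weyl_bianchi2 d g m k p k m.
have [F' FF' E] := weyl_frame_once.
have -> : F k m k p = 0.
  by rewrite !E /weyl_expansion !frE; ring.
have -> : F k m p m = - Psi1.
  by rewrite !E /weyl_expansion !frE; ring.
have -> : F k m m k = 0.
  by rewrite -[RHS]oppr0 -P0 !E /weyl_expansion !frE; ring.
have P0' : F' m k m k = 0 by rewrite FF'.
rewrite !along0 alongN; move: (along d k Psi1) => q.
rewrite !E /weyl_expansion; cbv zeta beta.
rewrite P0' /tau /omega /rdot !lie_dot !frE !connE => H; apply: subr0_eq.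
move/eqP: H; rewrite -subr_eq0 => /eqP H; rewrite -[RHS]oppr0 -[in RHS]H; ring.
Qed.

(** Cartan's second structure equation: curvature is the exterior derivative of the connection forms
    plus their quadratic terms, here expanded in the frame. *)
Lemma rm_frame V W X Y : rm V W X Y =
  along d X (dot (nab Y W) V) - along d Y (dot (nab X W) V)
  - dot (nab (lie d X Y) W) V
  - (dot (nab X V) p * dot (nab Y W) m + dot (nab X V) m * dot (nab Y W) p
     + dot (nab X V) k * dot (nab Y W) n + dot (nab X V) n * dot (nab Y W) k)
  + (dot (nab Y V) p * dot (nab X W) m + dot (nab Y V) m * dot (nab X W) p
     + dot (nab Y V) k * dot (nab X W) n + dot (nab Y V) n * dot (nab X W) k).
Proof.
rewrite -!(null_frame_dot (gmx_sym g) (gmxV g) fr) -![dot _ _]/(rdot g _ _).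
rewrite !nabla_metric /riem_form /curv !dotB2 ![rdot g _ V]dotC.
rewrite ![rdot g _ (nab _ V)]dotC.
ring.
Qed.

Section Integrable.
Hypotheses (omega_m : omega m = 0) (omega_k : omega k = 0).

(** On the null plane the Schouten terms drop out, so [Psi0] is a curvature component up to sign. In
    its structure equation each term contains [omega m], [omega k] or [omega] of their bracket, and
    the bracket lies in [N]. *)
Lemma Psi0_integrable : Psi0 = 0.
Proof.
have [F' FF' E] := weyl_frame_once.
have -> : Psi0 = - F k m m k by rewrite !E /weyl_expansion !frE; ring.
rewrite weylE /rdot !frE rm_frame.
rewrite -[dot (nab m m) k]/(omega m) -[dot (nab k m) k]/(omega k).
rewrite !connE -![dot (nab _ m) k]/(omega _) omega_m omega_k !along0.
have -> : omega (lie d m k) = 0.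
  rewrite /omega nabla_frame !lie_dot !connE.
  by rewrite -![dot (nab _ m) k]/(omega _) omega_m omega_k; ring.
by ring.
Qed.

Lemma along_lie_N x : along d (lie d m k) x =
  (dot (nab m k) p - dot (nab k m) p) * along d m x
  + (dot (nab m k) n - dot (nab k m) n) * along d k x.
Proof.
rewrite along_frame !lie_dot !connE -![dot (nab _ m) k]/(omega _).
by rewrite omega_m omega_k; ring.
Qed.

(** The left side is the curvature of [tau] on [m], [k], that is, the trace over [N] of the
    curvature operator. Its two Weyl components both equal [Psi1], and their Schouten terms cancel
    by symmetry. *)
Lemma curvature_tau : along d m (tau k) - along d k (tau m)
  - (dot (nab m k) p - dot (nab k m) p) * tau m
  - (dot (nab m k) n - dot (nab k m) n) * tau k = 2%:R * Psi1.
Proof.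
have [F' FF' E] := weyl_frame_once.
have -> : 2%:R * Psi1 = F p m m k + F n k m k.
  by rewrite !E /weyl_expansion !frE; ring.
rewrite !weylE /rdot !frE !rm_frame.
rewrite (nabla_frame (lie d m k) m) (nabla_frame (lie d m k) k).
rewrite /tau !lie_dot !connE !(alongD, alongN).
rewrite -![dot (nab m m) k]/(omega m) -![dot (nab k m) k]/(omega k).
by rewrite omega_m omega_k (sch_formC d g k m); ring.
Qed.

(** The sum of the structure equations of [omega] in the directions [m], [p] and [k], [n]. Only the
    derivatives of [omega p] and [omega n] survive, and the Schouten terms again cancel. *)
Lemma curvature_omega : along d m (omega p) + along d k (omega n)
  + (dot (nab m k) p - dot (nab k m) p) * omega n
  - (dot (nab m k) n - dot (nab k m) n) * omega p = 2%:R * Psi1.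
Proof.
have [F' FF' E] := weyl_frame_once.
have -> : 2%:R * Psi1 = F k m m p + F k m k n.
  by rewrite !E /weyl_expansion !frE; ring.
rewrite !weylE /rdot !frE !rm_frame.
rewrite (nabla_frame (lie d m p) m) (nabla_frame (lie d k n) m).
rewrite !lie_dot !connE.
rewrite -![dot (nab _ m) k]/(omega _) omega_m omega_k !along0.
rewrite (sch_formC d g k m).
ring.
Qed.

Lemma Psi1_sqr_integrable : C3 m m k = 0 -> C3 k m k = 0 ->
  10%:R * Psi1 ^+ 2 = 0.
Proof.
move=> Am Ak; have P0 := Psi0_integrable.
have Em := bianchi_m P0; have Ek := bianchi_k P0.
rewrite Am omega_m in Em; rewrite Ak omega_k in Ek.
have := along_lie d m k Psi1; rewrite along_lie_N Em Ek.
rewrite !(alongD, alongM, along0, along_nat, alongN) Em Ek.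
move/eqP; rewrite -subr_eq0 => /eqP H.
(* The split matches the two curvature identities, the second with weight [4] as in the Bianchi
   components; the commutator on [Psi1] then makes the sum vanish. *)
have -> : 10%:R * Psi1 ^+ 2 =
  (2%:R * Psi1) * Psi1 + 4%:R * ((2%:R * Psi1) * Psi1) by ring.
rewrite -{1}curvature_tau -curvature_omega -[RHS]oppr0 -[in RHS]H.
by rewrite /tau !alongD; ring.
Qed.

End Integrable.

End FrameField.

Local Open Scope classical_set_scope.
Local Open Scope ring_scope.

(** * Smooth functions *)

(** The difference [g - f] vanishes near [u], hence has differential zero there; adding it to [f]
    preserves differentiability. *)
Lemma near_eq_differentiable (R : numFieldType) (V W : normedModType R)
    (f g : V -> W) (u : V) :
  (\near u, f u = g u) -> differentiable f u -> differentiable g u.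
Proof.
move=> fg df; have -> : g = f + (g - f).
  by apply/funext => v /=; rewrite !fctE addrC subrK.
apply: differentiableD => //; set h := g - f.
have h0 : \near u, h u = 0.
  by apply: filterS fg => v; rewrite /h !fctE => ->; rewrite subrr.
have hu : h u = 0 by apply: nbhs_singleton h0.
have h0' : \forall y \near (0 : V), h (y + u) = 0.
  have := h0; rewrite (near_shift (0 : V)) /=.
  by apply: filterS => z /=; rewrite subr0.
have E : h \o shift u = cst (h u) + (0 : V -> W) +o_ 0 id.
  apply/eqaddoP => _/posnumP[e]; apply: filterS h0' => y hy.
  by rewrite !fctE /= hu addr0 subr0 hy normr0 mulr_ge0.
have c0 : continuous (\0 : V -> W) by apply: cst_continuous.
have D : 'd h u = \0 :> (V -> W) by apply: diff_unique.
by apply/diff_locallyP; rewrite D.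
Qed.

Section Smooth.
Variable R : realType.
Local Notation V := 'rV[R]_4.
Implicit Types (f g : V -> R) (U : set V) (u v : V).

Lemma open_near U u (P : V -> Prop) :
  open U -> U u -> (forall v, U v -> P v) -> \near u, P u.
Proof. by move=> oU Uu PU; apply: filterS PU _; apply: open_nbhs_nbhs. Qed.

Lemma partial_eq_on U f g a : open U -> (forall u, U u -> f u = g u) ->
  forall u, U u -> partial a f u = partial a g u.
Proof. by move=> oU fg u Uu; apply: near_eq_derive; apply: open_near fg. Qed.

(** [smooth_on] adds derivatives on the outside, whereas this recursion differentiates [f] first.
    The sum, product and quotient rules can thus be applied before the induction hypothesis. *)
Fixpoint smooth_upto (r : nat) U f : Prop :=
  (forall u, U u -> differentiable f u) /\
  if r is r'.+1 then forall a, smooth_upto r' U (partial a f) else True.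

Lemma smooth_upto_diff r U f u : smooth_upto r U f -> U u -> differentiable f u.
Proof. by case: r => [|r] [df _]; apply: df. Qed.

Lemma smooth_onP U f : smooth_on U f <-> forall r, smooth_upto r U f.
Proof.
split=> [sf r|sf s].
  elim: r f sf => [|r IH] f sf; (split; first exact: (sf [::])) => // a.
  by apply: IH => s u Uu; rewrite -foldr_rcons; apply: sf.
elim/last_ind: s f sf => [|s a IH] f sf u Uu; first by case: (sf 0%N) => + _;
  apply.
rewrite foldr_rcons; apply: IH => // r; by case: (sf r.+1) => _; apply.
Qed.

Lemma smooth_partial U f a : smooth_on U f -> smooth_on U (partial a f).
Proof. by move=> sf s u Uu; rewrite -foldr_rcons; apply: sf. Qed.

Lemma smooth_diff U f u : smooth_on U f -> U u -> differentiable f u.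
Proof. by move=> sf Uu; apply: (sf [::]). Qed.

Lemma smooth_upto_eq r U f g : open U -> (forall u, U u -> f u = g u) ->
  smooth_upto r U f -> smooth_upto r U g.
Proof.
move=> oU; elim: r f g => [|r IH] f g fg [df sf];
  (split; first by (move=> u Uu; apply: near_eq_differentiable (df u Uu);
    apply: open_near fg)) => // a.
by apply: IH (sf a) => u Uu; apply: partial_eq_on fg _ _.
Qed.

Lemma smooth_upto_le r U f : smooth_upto r.+1 U f -> smooth_upto r U f.
Proof.
elim: r f => [|r IH] f [df sf]; first by split.
by split=> // a; apply: IH; apply: sf.
Qed.

Lemma partialD f g a u : differentiable f u -> differentiable g u ->
  partial a (f + g) u = partial a f u + partial a g u.
Proof. by move=> df dg; apply: deriveD; apply: diff_derivable. Qed.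

Lemma partialN f a u : differentiable f u ->
  partial a (- f) u = - partial a f u.
Proof. by move=> df; apply: deriveN; apply: diff_derivable. Qed.

Lemma partialM f g a u : differentiable f u -> differentiable g u ->
  partial a (f * g) u = partial a f u * g u + f u * partial a g u.
Proof.
move=> df dg; rewrite /partial deriveM; [|exact: diff_derivable..].
by rewrite addrC /GRing.scale /=; ring.
Qed.

Lemma partialV f a u : differentiable f u -> f u != 0 ->
  partial a (fun v => (f v)^-1) u = - (partial a f u * ((f u)^-1 * (f u)^-1)).
Proof.
move=> df f0; rewrite /partial deriveV //; last exact: diff_derivable.
by rewrite /GRing.scale /= expr2 invfM; ring.
Qed.

Lemma partial_cst (c : R) a u : partial a (cst c) u = 0.
Proof. exact: derive_cst. Qed.

Lemma smooth_upto_cst r U c : smooth_upto r U (cst c).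
Proof.
elim: r c => [|r IH] c;
  (split; first by move=> u _; apply: differentiable_cst) => // a.
by rewrite (_ : partial a _ = cst 0) //; apply/funext => v; apply: partial_cst.
Qed.

Lemma smooth_uptoD r U f g : open U ->
  smooth_upto r U f -> smooth_upto r U g -> smooth_upto r U (f + g).
Proof.
move=> oU; elim: r f g => [|r IH] f g [df sf] [dg sg];
  (split; first by (move=> u Uu; apply: differentiableD;
    [apply: df|apply: dg])) => // a.
apply: (@smooth_upto_eq _ _ (partial a f + partial a g)) => // [u Uu|].
    by rewrite partialD //; [apply: df|apply: dg].
  by apply: IH; [apply: sf|apply: sg].
Qed.

Lemma smooth_uptoN r U f : open U -> smooth_upto r U f -> smooth_upto r U (- f).
Proof.
move=> oU; elim: r f => [|r IH] f [df sf];
  (split; first by (move=> u Uu; apply: differentiableN; apply: df)) => // a.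
apply: (@smooth_upto_eq _ _ (- partial a f)) => // [u Uu|].
    by rewrite partialN //; apply: df.
  by apply: IH; apply: sf.
Qed.

Lemma smooth_uptoM r U f g : open U ->
  smooth_upto r U f -> smooth_upto r U g -> smooth_upto r U (f * g).
Proof.
move=> oU; elim: r f g => [|r IH] f g sf sg;
  (split; first by (move=> u Uu; apply: differentiableM;
    [apply: (smooth_upto_diff sf)|apply: (smooth_upto_diff sg)])) => // a.
apply: (@smooth_upto_eq _ _ (partial a f * g + f * partial a g)) => // [u Uu|].
    by rewrite partialM //;
      [apply: (smooth_upto_diff sf)|apply: (smooth_upto_diff sg)].
  case: (sf) (sg) => [_ pf] [_ pg].
  apply: smooth_uptoD => //; apply: IH => //; try exact: smooth_upto_le.
  - exact: pf.
  - exact: pg.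
Qed.

(** The derivative of the inverse is a product involving the inverse itself, whose smoothness to one
    order less is the induction hypothesis. *)
Lemma smooth_uptoV r U f : open U -> (forall u, U u -> f u != 0) ->
  smooth_upto r U f -> smooth_upto r U (fun v => (f v)^-1).
Proof.
move=> oU f0; elim: r => [|r IH] sf;
  (split; first by (move=> u Uu; apply: differentiableV;
    [apply: (smooth_upto_diff sf)|apply: f0])) => // a.
pose h v := (f v)^-1.
  apply: (@smooth_upto_eq _ _ (- (partial a f * (h * h)))) => // [u Uu|].
    by rewrite partialV //; [apply: (smooth_upto_diff sf)|apply: f0].
  case: (sf) => [_ pf]; apply: smooth_uptoN => //.
  have sh : smooth_upto r U h by apply: IH; apply: smooth_upto_le.
  by apply: smooth_uptoM => //; [apply: pf|apply: smooth_uptoM].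
Qed.

Lemma smooth_eq U f g : open U -> (forall u, U u -> f u = g u) ->
  smooth_on U f -> smooth_on U g.
Proof.
move=> oU fg /smooth_onP sf; apply/smooth_onP => r.
exact: smooth_upto_eq (sf r).
Qed.

Lemma smooth_cst U c : smooth_on U (cst c).
Proof. by apply/smooth_onP => r; apply: smooth_upto_cst. Qed.
Lemma smoothD U f g : open U -> smooth_on U f -> smooth_on U g ->
  smooth_on U (f + g).
Proof.
by move=> oU /smooth_onP sf /smooth_onP sg; apply/smooth_onP => r;
  apply: smooth_uptoD.
Qed.
Lemma smoothN U f : open U -> smooth_on U f -> smooth_on U (- f).
Proof. by move=> oU /smooth_onP sf; apply/smooth_onP => r;
  apply: smooth_uptoN. Qed.
Lemma smoothM U f g : open U -> smooth_on U f -> smooth_on U g ->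
  smooth_on U (f * g).
Proof.
by move=> oU /smooth_onP sf /smooth_onP sg; apply/smooth_onP => r;
  apply: smooth_uptoM.
Qed.
Lemma smoothV U f : open U -> (forall u, U u -> f u != 0) -> smooth_on U f ->
  smooth_on U (fun v => (f v)^-1).
Proof.
by move=> oU f0 /smooth_onP sf; apply/smooth_onP => r; apply: smooth_uptoV.
Qed.

Lemma smooth_sub U U' f : U' `<=` U -> smooth_on U f -> smooth_on U' f.
Proof. by move=> UU' sf s u /UU'; apply: sf. Qed.

Lemma is_derive_line f u v (s : R) : derivable f (u + s *: v) v ->
  is_derive s 1 (fun x : R => f (u + x *: v)) ('D_v f (u + s *: v)).
Proof.
move=> df.
have E : (fun h : R => h^-1 *: (((fun x :
  R => f (u + x *: v)) \o shift s) (h *: 1)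
      - f (u + s *: v))) =
    (fun h : R => h^-1 *: ((f \o shift (u + s *: v))
      (h *: v) - f (u + s *: v))).
  apply/funext => h /=; congr (_ *: (f _ - _)).
  by rewrite [h *: 1]mulr1 scalerDl addrCA.
by split; rewrite /derivable /derive E.
Qed.

Lemma mvt_line f v (w : V) (h : R) : 0 < h ->
  (forall s, 0 <= s <= h -> derivable f (w + s *: v) v) ->
  exists2 s, 0 <= s <= h & f (w + h *: v) - f w = h * 'D_v f (w + s *: v).
Proof.
move=> h0 df.
have dl s : 0 <= s <= h ->
    is_derive s 1 (fun x : R => f (w + x *: v)) ('D_v f (w + s *: v)).
  by move=> sh; apply: is_derive_line; apply: df.
have [s /itvP sh E] : exists2 c, c \in `]0, h[%R &
    f (w + h *: v) - f (w + 0 *: v) = 'D_v f (w + c *: v) * (h - 0).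
  apply: (MVT (f := fun x => f (w + x *: v))) => // [s /itvP sh|].
    by apply: dl; rewrite !sh.
  apply: derivable_within_continuous => s /itvP sh.
  by have [] := dl s _; rewrite ?sh.
exists s; first by rewrite !sh.
by move: E; rewrite scale0r addr0 subr0 mulrC.
Qed.

Lemma is_derive_translate f u v w : derivable f (u + w) v ->
  is_derive u v (fun x => f (x + w)) ('D_v f (u + w)).
Proof.
move=> df.
have E : (fun h : R => h^-1 *: (((fun x => f (x + w)) \o shift u) (h *: v)
      - f (u + w))) =
    (fun h : R => h^-1 *: ((f \o shift (u + w)) (h *: v) - f (u + w))).
  by apply/funext => h /=; rewrite addrA.
by split; rewrite /derivable /derive E.
Qed.

(** Two applications of the mean value theorem: along [a] to the difference [phi] of [f] in
    direction [b], then along [b] to the resulting derivative. *)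
Lemma second_difference U f a b u (h : R) : 0 < h -> smooth_on U f ->
  let p s t := u + s *: delta_mx 0 a + t *: delta_mx 0 b in
  (forall s t, 0 <= s <= h -> 0 <= t <= h -> U (p s t)) ->
  exists s t, [/\ 0 <= s <= h, 0 <= t <= h &
    f (p h h) - f (p h 0) - (f (p 0 h) - f (p 0 0)) =
    h * h * partial b (partial a f) (p s t)].
Proof.
move=> h0 sf p pU.
pose phi : V -> R := (fun v => f (v + h *: delta_mx 0 b)) - f.
have hh : 0 <= h <= h by rewrite lexx ltW.
have h00 : 0 <= (0 : R) <= h by apply/andP; split; rewrite ?lexx ?ltW.
have df v c : U v -> derivable f v c.
  by move=> Uv; apply: diff_derivable; apply: smooth_diff Uv.
have dphi s : 0 <= s <= h ->
  is_derive (u + s *: delta_mx 0 a) (delta_mx 0 a) phi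
    (partial a f (p s h) - partial a f (p s 0)).
  move=> sh; apply: is_deriveB.
    by apply: is_derive_translate; apply: df; apply: pU.
  have := pU s 0 sh h00; rewrite /p scale0r addr0 => Us.
  by apply: derivableP; apply: df.
have [s sh E1] : exists2 s, 0 <= s <= h & phi (u + h *: delta_mx 0 a) - phi u =
    h * 'D_(delta_mx 0 a) phi (u + s *: delta_mx 0 a).
  by apply: mvt_line => // s /dphi[].
have [t th E2] : exists2 t, 0 <= t <= h &
    partial a f (u + s *: delta_mx 0 a + h *: delta_mx 0 b)
    - partial a f (u + s *: delta_mx 0 a) =
    h * 'D_(delta_mx 0 b) (partial a f) (p s t).
  apply: mvt_line => // t th; apply: diff_derivable.
  by apply: smooth_diff (smooth_partial a sf) _; apply: pU.
exists s, t; split => //; move: E1; have [_ ->] := dphi s sh.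
rewrite /p !scale0r !addr0 E2 mulrA => <-.
by rewrite /phi !fctE.
Qed.

(** The second difference over a small square is symmetric in the two directions. It therefore
    equates the two mixed derivatives at points arbitrarily close to [u], and continuity
    concludes. *)
Lemma partial_comm U f a b u : open U -> smooth_on U f -> U u ->
  partial a (partial b f) u = partial b (partial a f) u.
Proof.
move=> oU sf Uu; set F := partial a _; set G := partial b _.
have cF : {for u, continuous F}.
  by apply: differentiable_continuous; apply: (sf [:: a; b]).
have cG : {for u, continuous G}.
  by apply: differentiable_continuous; apply: (sf [:: b; a]).
apply/eqP; rewrite -subr_eq0 -normr_le0; apply/ler_addgt0Pr => e e0.
rewrite add0r -/(F u) -/(G u).
have e20 : 0 < e / 2 by rewrite divr_gt0.
have : \forall v \near u, [/\ U v, `|F u - F v| < e / 2 & `|G v - G u| < e / 2].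
  have H1 : \forall v \near u, `|F u - F v| < e / 2.
    by have /cvgrPdist_lt/(_ _ e20) := cF.
  have H2 : \forall v \near u, `|G v - G u| < e / 2.
    by have /cvgrPdistC_lt/(_ _ e20) := cG.
  have H3 : \forall v \near u, U v by apply: open_near Uu _.
  by apply: filterS3 H1 H2 H3 => v *; split.
rewrite -nbhs_nearE => /nbhs_normP[r /= r0 Br].
pose ea : V := delta_mx 0 a; pose eb : V := delta_mx 0 b.
pose m := `|ea| + `|eb|; have m0 : 0 <= m by rewrite addr_ge0.
(* With this side length the whole square lies in the ball of radius [r]; the added [1] keeps the
   denominator positive. *)
pose h := r / (m + 1); have h0 : 0 < h by rewrite divr_gt0 // ltr_wpDl.
have near_p s t : 0 <= s <= h -> 0 <= t <= h ->
    ball_ (fun x => `|x|) u r (u + s *: ea + t *: eb).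
  move=> /andP[s0 sh] /andP[t0 th] /=.
  rewrite -addrA opprD addrA subrr sub0r normrN.
  apply: (le_lt_trans (ler_normD _ _)); rewrite !normrZ !ger0_norm //.
  apply: (@le_lt_trans _ _ (h * m)).
    by rewrite mulrDr lerD // ler_wpM2r.
  by rewrite /h mulrAC -mulrA gtr_pMr // ltr_pdivrMr ?mul1r ?ltrDl // ltr_wpDl.
have [s [t [sh th Eab]]] := second_difference (a := a) (b := b) h0 sf
  (fun s t sh th => let: And3 x _ _ := Br _ (near_p s t sh th) in x).
have near_p' s' t' : 0 <= s' <= h -> 0 <= t' <= h ->
    ball_ (fun x => `|x|) u r (u + s' *: eb + t' *: ea).
  by move=> sh' th'; rewrite addrAC; apply: near_p.
have [s' [t' [sh' th' Eba]]] := second_difference (a := b) (b := a) h0 sf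
  (fun s t sh th => let: And3 x _ _ := Br _ (near_p' s t sh th) in x).
have E : G (u + s *: ea + t *: eb) = F (u + s' *: eb + t' *: ea).
  have hh : h * h != 0 by rewrite mulf_neq0 // gt_eqF.
  apply: (mulfI hh); etransitivity; first exact: (esym Eab).
  etransitivity; last exact: Eba.
  rewrite !scale0r !addr0 (addrAC u (h *: delta_mx 0 b)).
  by ring.
have [_ HF _] := Br _ (near_p' _ _ sh' th').
have [_ _ HG] := Br _ (near_p _ _ sh th).
move: (F u) (F _) (G u) (G _) E HF HG => x y z w -> /ltW xy /ltW yz.
rewrite (_ : x - z = (x - y) + (y - z)); last by rewrite addrA subrK.
by apply: (le_trans (ler_normD _ _)); rewrite [leRHS]splitr lerD.
Qed.

End Smooth.

Section ComplexSmooth.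
Variable R : realType.
Local Notation V := 'rV[R]_4.
Local Notation C := R[i].
Local Notation re := complex.Re.
Local Notation im := complex.Im.
Implicit Types (f g : V -> C) (U : set V) (u v : V).

Lemma complex_ext (x y : C) : re x = re y -> im x = im y -> x = y.
Proof. by case: x y => [? ?] [? ?] /= -> ->. Qed.

Lemma reD (x y : C) : re (x + y) = re x + re y. Proof. by case: x y => [? ?]
  []. Qed.
Lemma imD (x y : C) : im (x + y) = im x + im y. Proof. by case: x y => [? ?]
  []. Qed.
Lemma reN (x : C) : re (- x) = - re x. Proof. by case: x. Qed.
Lemma imN (x : C) : im (- x) = - im x. Proof. by case: x. Qed.
Lemma reM (x y : C) : re (x * y) = re x * re y - im x * im y.
Proof. by case: x y => [? ?] []. Qed.
Lemma imM (x y : C) : im (x * y) = re x * im y + im x * re y.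
Proof. by case: x y => [? ?] []. Qed.

Lemma csmooth_eq U f g : open U -> (forall u, U u -> f u = g u) ->
  csmooth_on U f -> csmooth_on U g.
Proof.
move=> oU fg [sr si]; split.
  by apply: smooth_eq sr => // u Uu; rewrite fg.
by apply: smooth_eq si => // u Uu; rewrite fg.
Qed.

Lemma csmooth_cst U c : csmooth_on U (cst c).
Proof. by split; apply: smooth_cst. Qed.

Lemma csmoothD U f g : open U -> csmooth_on U f -> csmooth_on U g ->
  csmooth_on U (fun u => f u + g u).
Proof.
move=> oU [fr fi] [gr gi]; split.
  by apply: smooth_eq (smoothD oU fr gr) => // u _; rewrite reD.
by apply: smooth_eq (smoothD oU fi gi) => // u _; rewrite imD.
Qed.

Lemma csmoothN U f : open U -> csmooth_on U f -> csmooth_on U (fun u => - f u).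
Proof.
move=> oU [fr fi]; split.
  by apply: smooth_eq (smoothN oU fr) => // u _; rewrite reN.
by apply: smooth_eq (smoothN oU fi) => // u _; rewrite imN.
Qed.

Lemma csmoothM U f g : open U -> csmooth_on U f -> csmooth_on U g ->
  csmooth_on U (fun u => f u * g u).
Proof.
move=> oU [fr fi] [gr gi]; split.
  apply: smooth_eq (smoothD oU (smoothM oU fr gr)
    (smoothN oU (smoothM oU fi gi))) => // u _.
  by rewrite reM.
apply: smooth_eq (smoothD oU (smoothM oU fr gi) (smoothM oU fi gr)) => // u _.
by rewrite imM.
Qed.

(** Real and imaginary parts of the inverse have the squared modulus as denominator, which is
    nonzero where [f] is. *)
Lemma csmoothV U f : open U -> (forall u, U u -> f u != 0) -> csmooth_on U f ->
  csmooth_on U (fun u => (f u)^-1).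
Proof.
move=> oU f0 [fr fi].
have sn := smoothD oU (smoothM oU fr fr) (smoothM oU fi fi).
have n0 u : U u -> re (f u) * re (f u) + im (f u) * im (f u) != 0.
  move=> /f0; apply: contra => /eqP H; apply/eqP; apply: complex_ext => /=; nra.
have sV := smoothV oU n0 sn; split.
  apply: smooth_eq (smoothM oU fr sV) => // u _; rewrite !fctE.
  by case: (f u) => x y /=; rewrite !expr2.
apply: smooth_eq (smoothN oU (smoothM oU fi sV)) => // u _; rewrite !fctE.
by case: (f u) => x y /=; rewrite !expr2.
Qed.

Lemma csmooth_cpartial U f a : csmooth_on U f -> csmooth_on U (cpartial a f).
Proof. by move=> [fr fi]; split; apply: smooth_partial. Qed.

Lemma csmooth_sub U U' f : U' `<=` U -> csmooth_on U f -> csmooth_on U' f.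
Proof. by move=> UU' [fr fi]; split; apply: smooth_sub UU' _. Qed.

Lemma cpartial_eq_on U f g a : open U -> (forall u, U u -> f u = g u) ->
  forall u, U u -> cpartial a f u = cpartial a g u.
Proof.
move=> oU fg u Uu; apply: complex_ext;
  by apply: partial_eq_on Uu => // v Uv; rewrite fg.
Qed.

Lemma cpartialD U f g a u : csmooth_on U f -> csmooth_on U g -> U u ->
  cpartial a (fun v => f v + g v) u = cpartial a f u + cpartial a g u.
Proof.
move=> [fr fi] [gr gi] Uu; apply: complex_ext; rewrite (reD, imD) /=.
  rewrite -partialD; [|exact: smooth_diff Uu..].
  suff -> : (fun v => re (f v + g v)) = (fun v => re (f v)) + (fun v => re (g
    v)).
    by [].
  by apply/funext => v; rewrite reD.
rewrite -partialD; [|exact: smooth_diff Uu..].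
suff -> : (fun v => im (f v + g v)) = (fun v => im (f v)) + (fun v => im (g v)).
  by [].
by apply/funext => v; rewrite imD.
Qed.

Lemma cpartialM U f g a u : csmooth_on U f -> csmooth_on U g -> U u ->
  cpartial a (fun v => f v * g v) u = cpartial a f u * g u + f u * cpartial a
    g u.
Proof.
move=> [fr fi] [gr gi] Uu.
have D h : smooth_on U h -> differentiable h u by move=> /smooth_diff; apply.
apply: complex_ext.
  rewrite reD !reM /= (_ : (fun v => re (f v * g v)) =
    (fun v => re (f v)) * (fun v => re (g v))
    + - ((fun v => im (f v)) * (fun v => im (g v)))); last first.
    by apply/funext => v; rewrite reM.
  rewrite partialD ?partialN ?partialM; do ?exact: D;
    do ?[apply: differentiableM; exact: D]; first by ring.
  by apply: differentiableN; apply: differentiableM; exact: D.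
rewrite imD !imM /= (_ : (fun v => im (f v * g v)) =
    (fun v => re (f v)) * (fun v => im (g v))
    + (fun v => im (f v)) * (fun v => re (g v))); last first.
  by apply/funext => v; rewrite imM.
rewrite partialD ?partialM; do ?exact: D;
  do ?[apply: differentiableM; exact: D]; by ring.
Qed.

Lemma cpartial_comm U f a b u : open U -> csmooth_on U f -> U u ->
  cpartial a (cpartial b f) u = cpartial b (cpartial a f) u.
Proof.
move=> oU [fr fi] Uu; apply: complex_ext => /=;
  [exact: partial_comm Uu | exact: partial_comm Uu].
Qed.

End ComplexSmooth.

(** * The ring of smooth functions on an open set *)

Record open_set (R : realType) :=
  OpenSet { os_set : set 'rV[R]_4; os_open : open os_set }.

(* Extending by zero outside [U] makes equality on [U] Leibniz equality. *)
Record smooth_fun (R : realType) (U : open_set R) := SmoothFun {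
  sfun :> 'rV[R]_4 -> R[i];
  sfun_smooth : csmooth_on (os_set U) sfun;
  sfun_out : forall u, ~ os_set U u -> sfun u = 0 }.

HB.instance Definition _ R (U : open_set R) := gen_eqMixin (smooth_fun U).
HB.instance Definition _ R (U : open_set R) := gen_choiceMixin (smooth_fun U).

Section SmoothRing.
Variables (R : realType) (U : open_set R).
Local Notation V := 'rV[R]_4.
Local Notation C := R[i].
Implicit Types (f g h : smooth_fun U) (u v : V).

Lemma smooth_fun_ext f g : (forall u, os_set U u -> f u = g u) -> f = g.
Proof.
move=> fg; have E : sfun f = sfun g.
  apply/funext => u; have [/fg //|nU] := pselect (os_set U u).
  by rewrite !sfun_out.
case: f g E {fg} => f sf f0 [g sg g0] /= E; rewrite E in sf f0 *.
by congr SmoothFun; apply: Prop_irrelevance.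
Qed.

Lemma restrict_smooth (F : V -> C) : csmooth_on (os_set U) F ->
  csmooth_on (os_set U) (fun u => if `[< os_set U u >] then F u else 0).
Proof.
move=> sF; apply: (csmooth_eq (f := F)) => // [|u Uu]; first exact: os_open.
by rewrite asboolT.
Qed.

Lemma restrict_out (F : V -> C) u : ~ os_set U u ->
  (if `[< os_set U u >] then F u else 0) = 0.
Proof. by move=> nU; rewrite asboolF. Qed.

Definition restr (F : V -> C) (sF : csmooth_on (os_set U) F) : smooth_fun U :=
  SmoothFun (restrict_smooth sF) (@restrict_out F).

Lemma restrE (F : V -> C) (sF : csmooth_on (os_set U) F) u : os_set U u ->
  restr sF u = F u.
Proof. by move=> Uu; rewrite /= asboolT. Qed.

Let zero := restr (csmooth_cst (os_set U) 0).
Let one := restr (csmooth_cst (os_set U) 1).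
Let add f g := restr (csmoothD (@os_open R U) (sfun_smooth f) (sfun_smooth g)).
Let opp f := restr (csmoothN (@os_open R U) (sfun_smooth f)).
Let mul f g := restr (csmoothM (@os_open R U) (sfun_smooth f) (sfun_smooth g)).

Let addA : associative add.
Proof. by move=> f g h; apply: smooth_fun_ext => u Uu;
  rewrite !restrE // addrA. Qed.
Let addC : commutative add.
Proof. by move=> f g; apply: smooth_fun_ext => u Uu;
  rewrite !restrE // addrC. Qed.
Let add0 : left_id zero add.
Proof. by move=> f; apply: smooth_fun_ext => u Uu;
  rewrite !restrE // add0r. Qed.
Let addN : left_inverse zero opp add.
Proof. by move=> f; apply: smooth_fun_ext => u Uu;
  rewrite !restrE // addNr. Qed.
Let mulA : associative mul.
Proof. by move=> f g h; apply: smooth_fun_ext => u Uu;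
  rewrite !restrE // mulrA. Qed.
Let mulC : commutative mul.
Proof. by move=> f g; apply: smooth_fun_ext => u Uu;
  rewrite !restrE // mulrC. Qed.
Let mul1 : left_id one mul.
Proof. by move=> f; apply: smooth_fun_ext => u Uu;
  rewrite !restrE // mul1r. Qed.
Let mulD : left_distributive mul add.
Proof. by move=> f g h; apply: smooth_fun_ext => u Uu;
  rewrite !restrE // mulrDl. Qed.

HB.instance Definition _ :=
  GRing.isZmodule.Build (smooth_fun U) addA addC add0 addN.
HB.instance Definition _ :=
  GRing.Zmodule_isComPzRing.Build (smooth_fun U) mulA mulC mul1 mulD.

Section Eval.
Variables (u : V) (Uu : os_set U u).

Definition sfun_eval of os_set U u := fun f => f u.

Lemma sfun_eval_zmod : zmod_morphism (sfun_eval Uu).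
Proof. by move=> f g; rewrite /sfun_eval !restrE. Qed.

Lemma sfun_eval_monoid : monoid_morphism (sfun_eval Uu).
Proof. by split=> [|f g]; rewrite /sfun_eval restrE. Qed.

End Eval.

HB.instance Definition _ u (Uu : os_set U u) :=
  GRing.isZmodMorphism.Build (smooth_fun U) C (sfun_eval Uu)
    (sfun_eval_zmod Uu).
HB.instance Definition _ u (Uu : os_set U u) :=
  GRing.isMonoidMorphism.Build (smooth_fun U) C (sfun_eval Uu)
    (sfun_eval_monoid Uu).

Definition sderiv (a : 'I_4) f : smooth_fun U :=
  restr (csmooth_cpartial a (sfun_smooth f)).

Lemma sderivE a f u : os_set U u -> sderiv a f u = cpartial a f u.
Proof. exact: restrE. Qed.

Lemma sfunD f g u : os_set U u -> (f + g : smooth_fun U) u = f u + g u.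
Proof. exact: restrE. Qed.
Lemma sfunM f g u : os_set U u -> (f * g : smooth_fun U) u = f u * g u.
Proof. exact: restrE. Qed.

Lemma sderivD a : {morph sderiv a : f g / f + g}.
Proof.
move=> f g; apply: smooth_fun_ext => u Uu; rewrite sfunD // !sderivE //.
rewrite -(cpartialD _ (sfun_smooth f) (sfun_smooth g)) //.
by apply: cpartial_eq_on (@os_open R U) _ _ Uu => v Uv; rewrite sfunD.
Qed.

Lemma sderivM a f g : sderiv a (f * g) = sderiv a f * g + f * sderiv a g.
Proof.
apply: smooth_fun_ext => u Uu; rewrite sfunD // !sfunM // !sderivE //.
rewrite -(cpartialM _ (sfun_smooth f) (sfun_smooth g)) //.
by apply: cpartial_eq_on (@os_open R U) _ _ Uu => v Uv; rewrite sfunM.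
Qed.

Lemma sderivC a b f : sderiv a (sderiv b f) = sderiv b (sderiv a f).
Proof.
apply: smooth_fun_ext => u Uu.
have E c e : sderiv c (sderiv e f) u = cpartial c (cpartial e f) u.
  rewrite sderivE; last exact: Uu.
  by apply: (cpartial_eq_on _ (@os_open R U) _ Uu) => v Uv; apply: sderivE.
have K := cpartial_comm a b (@os_open R U) (sfun_smooth f) Uu.
exact: (etrans (E a b) (etrans K (esym (E b a)))).
Qed.

Definition sderivs : commuting_derivations (smooth_fun U) 4 :=
  Build_commuting_derivations sderivD sderivM sderivC.

End SmoothRing.

(* The ring of smooth functions is used only through this interface:
   unification would unfold the operations of [smooth_fun]. *)
Record smooth_model (R : realType) (U : set 'rV[R]_4) := SmoothModel {
  sm_ring :> comPzRingType;
  sm_deriv : commuting_derivations sm_ring 4;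
  ev : forall u, U u -> {rmorphism sm_ring -> R[i]};
  ev_inj : forall f h, (forall u (Uu : U u), ev Uu f = ev Uu h) -> f = h;
  ev_lift : forall F, csmooth_on U F ->
    exists f, forall u (Uu : U u), ev Uu f = F u;
  ev_smooth : forall f, exists2 F, csmooth_on U F &
    forall u (Uu : U u), ev Uu f = F u;
  ev_deriv : forall a f F u (Uu : U u),
    (forall v (Uv : U v), ev Uv f = F v) ->
    ev Uu (sm_deriv a f) = cpartial a F u
}.

Lemma exists_smooth_model (R : realType) (U : set 'rV[R]_4) : open U ->
  inhabited (smooth_model U).
Proof.
move=> oU; pose W := OpenSet oU; split.
apply: (@SmoothModel R U (smooth_fun W) (sderivs W)
  (fun u (Uu : os_set W u) => sfun_eval Uu)).
- by move=> f h fh; apply: smooth_fun_ext => u Uu; apply: fh.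
- by move=> F sF; exists (restr (U := W) sF) => u Uu; apply: restrE.
- by move=> f; exists (sfun f) => [|u Uu]; [apply: (sfun_smooth f)|].
- move=> a f F u Uu fF.
  apply: (etrans (sderivE a f Uu)).
  by apply: (cpartial_eq_on _ oU _ Uu) => v Uv; apply: fF.
Qed.

Section SmoothModel.
Variables (R : realType) (U : set 'rV[R]_4) (S : smooth_model U).
Local Notation V := 'rV[R]_4.
Local Notation C := R[i].
Hypothesis oU : open U.

Definition lift (F : V -> C) (sF : csmooth_on U F) : S :=
  sval (cid (ev_lift S sF)).

Lemma liftE (F : V -> C) (sF : csmooth_on U F) u (Uu : U u) :
  ev S Uu (lift sF) = F u.
Proof. by rewrite /lift; case: cid => f /= ->. Qed.

Lemma ev_unit (f : S) : (forall u (Uu : U u), ev S Uu f != 0) ->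
  exists h, h * f = 1.
Proof.
move=> f0; have [F sF fF] := ev_smooth f.
have F0 u : U u -> F u != 0 by move=> Uu; rewrite -(fF _ Uu).
exists (lift (csmoothV oU F0 sF)); apply: (ev_inj (s := S)) => u Uu.
by rewrite rmorphM rmorph1 liftE fF mulVf // F0.
Qed.

Variable G : 'rV[R]_4 -> 'M[R[i]]_4.
Hypothesis sG : forall a b, csmooth_on U (fun u => G u a b).
Hypothesis Gsym : forall u, U u -> (G u)^T = G u.
Hypothesis Gunit : forall u, U u -> G u \in unitmx.

Lemma exists_metric : exists g : ring_metric S 4, forall u (Uu : U u) a b,
  [/\ ev S Uu (gmx g a b) = G u a b, ev S Uu (ginv g a b) = invmx (G u) a b &
      ev S Uu (twelfth g) = 12^-1].
Proof.
pose gS : 'M[S]_4 := \matrix_(a, b) lift (sG a b).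
have evg u (Uu : U u) : map_mx (ev S Uu) gS = G u.
  by apply/matrixP => a b; rewrite !mxE liftE.
have [h hE] : exists h, h * \det gS = 1.
  apply: ev_unit => u Uu; rewrite -det_map_mx evg.
  by have := Gunit Uu; rewrite unitmxE unitfE.
have gsym : gS^T = gS.
  apply/matrixP => a b; rewrite !mxE; apply: (ev_inj (s := S)) => u Uu.
  by rewrite !liftE -{1}(Gsym Uu) mxE.
(* The ring carries no unit structure, so the inverse metric is the adjugate scaled by an inverse of
   the determinant. *)
have ginvE : (h *: \adj gS) *m gS = 1%:M.
  by rewrite -scalemxAl mul_adj_mx scale_scalar_mx hE.
pose t := lift (csmooth_cst U 12%:R^-1).
have tE : 12%:R * t = 1.
  apply: (ev_inj (s := S)) => u Uu.
  by rewrite rmorphM rmorph_nat rmorph1 liftE mulfV // pnatr_eq0.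
exists (Build_ring_metric gsym ginvE tE) => u Uu a b; split => /=.
- by rewrite -(evg u Uu) [RHS]mxE.
- suff <- : map_mx (ev S Uu) (h *: \adj gS) = invmx (G u) by rewrite [RHS]mxE.
  have : map_mx (ev S Uu) ((h *: \adj gS) *m gS) = 1%:M.
    by rewrite ginvE map_mx1.
  rewrite map_mxM evg => /(congr1 (mulmx^~ (invmx (G u)))).
  by rewrite /= mulmxK ?Gunit // mul1mx.
- by rewrite liftE.
Qed.

End SmoothModel.

(** * Evaluation of the curvature tensors at a point *)

Section EvaluateCurvature.
Variables (R : realType) (U : set 'rV[R]_4) (S : smooth_model U).
Variables (G : 'rV[R]_4 -> 'M[R[i]]_4) (g : ring_metric S 4).
Local Notation V := 'rV[R]_4.
Local Notation C := R[i].
Local Notation d := (sm_deriv S).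
Hypothesis gE : forall u (Uu : U u) a b,
  [/\ ev S Uu (gmx g a b) = G u a b, ev S Uu (ginv g a b) = invmx (G u) a b &
      ev S Uu (twelfth g) = 12^-1].

Lemma ev_gmx u (Uu : U u) a b : ev S Uu (gmx g a b) = G u a b.
Proof. by case: (gE Uu a b). Qed.
Lemma ev_ginv u (Uu : U u) a b : ev S Uu (ginv g a b) = invmx (G u) a b.
Proof. by case: (gE Uu a b). Qed.
Lemma ev_twelfth u (Uu : U u) : ev S Uu (twelfth g) = 12^-1.
Proof. by case: (gE Uu 0 0). Qed.
Lemma ev_half u (Uu : U u) : ev S Uu (rhalf g) = 2^-1.
Proof. by rewrite /rhalf rmorphM rmorph_nat ev_twelfth; field. Qed.

Lemma ev_chr u (Uu : U u) a b c :
  ev S Uu (rchristoffel d g a b c) = christoffel G a b c u.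
Proof.
rewrite /rchristoffel /christoffel rmorphM ev_half rmorph_sum; congr (_ * _).
apply: eq_bigr => e _; rewrite rmorphM rmorphB rmorphD ev_ginv.
have E i j k : ev S Uu (d i (gmx g j k)) = cpartial i (fun v => G v j k) u.
  by apply: ev_deriv => v Uv; apply: ev_gmx.
by rewrite !E.
Qed.

Lemma ev_riem_up u (Uu : U u) a b c e :
  ev S Uu (rriemann_up d g a b c e) = riemann_up G a b c e u.
Proof.
rewrite /rriemann_up /riemann_up rmorphD rmorphB rmorph_sum.
have E i j k l : ev S Uu (d i (rchristoffel d g j k l)) = cpartial i
  (christoffel G j k l) u.
  by apply: ev_deriv => v Uv; apply: ev_chr.
congr (_ - _ + _); [exact: E|exact: E|apply: eq_bigr => f _].
by rewrite rmorphB; congr (_ - _); rewrite rmorphM; congr (_ * _);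
  apply: ev_chr.
Qed.

Lemma ev_riem u (Uu : U u) a b c e :
  ev S Uu (rriemann d g a b c e) = riemann G a b c e u.
Proof.
rewrite /rriemann /riemann rmorph_sum; apply: eq_bigr => f _.
by rewrite rmorphM; congr (_ * _); [apply: ev_gmx|apply: ev_riem_up].
Qed.

Lemma ev_ric u (Uu : U u) a b : ev S Uu (rricci d g a b) = ricci G a b u.
Proof.
by rewrite /rricci /ricci rmorph_sum; apply: eq_bigr => f _; apply: ev_riem_up.
Qed.

Lemma ev_scal u (Uu : U u) : ev S Uu (rscalar d g) = scalar_curvature G u.
Proof.
rewrite /rscalar /scalar_curvature rmorph_sum; apply: eq_bigr => a _.
rewrite rmorph_sum; apply: eq_bigr => b _.
by rewrite rmorphM; congr (_ * _); [apply: ev_ginv|apply: ev_ric].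
Qed.

Lemma ev_sch u (Uu : U u) a b : ev S Uu (rschouten d g a b) = schouten G a b u.
Proof.
rewrite /rschouten /schouten rmorphB; congr (_ - _); rewrite rmorphM;
  congr (_ * _).
- exact: ev_half.
- exact: ev_ric.
- by rewrite rmorphM; congr (_ * _); [apply: ev_twelfth|apply: ev_scal].
- exact: ev_gmx.
Qed.

Lemma ev_wl u (Uu : U u) a b c e :
  ev S Uu (rweyl d g a b c e) = weyl G a b c e u.
Proof.
have M i j k l : ev S Uu (gmx g i j * rschouten d g k l) = G u i j * schouten
  G k l u.
  by rewrite rmorphM; congr (_ * _); [apply: ev_gmx|apply: ev_sch].
rewrite /rweyl /weyl rmorphB rmorphD rmorphB rmorphD.
by congr (_ + _ - _ + _ - _); [apply: ev_riem|apply: M..].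
Qed.

Lemma ev_cot u (Uu : U u) a b c :
  ev S Uu (rcotton d g a b c) = cotton G a b c u.
Proof.
have E i j k : ev S Uu (nabla2 d g (rschouten d g) i j k) = nabla_schouten G i
  j k u.
  rewrite /nabla2 /nabla_schouten rmorphB rmorph_sum.
  congr (_ - _).
    by apply: ev_deriv => v Uv; apply: ev_sch.
  apply: eq_bigr => f _.
  by rewrite rmorphD; congr (_ + _); rewrite rmorphM; congr (_ * _);
    do ?[exact: ev_chr | exact: ev_sch].
by rewrite /rcotton /cotton rmorphB; congr (_ - _); apply: E.
Qed.

Lemma ev_weyl_form u (Uu : U u) (V1 V2 V3 V4 : 'rV[S]_4) :
  ev S Uu (form4 (rweyl d g) V1 V2 V3 V4) = weyl_form G u (map_mx (ev S Uu) V1)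
    (map_mx (ev S Uu) V2) (map_mx (ev S Uu) V3) (map_mx (ev S Uu) V4).
Proof.
rewrite /form4 /weyl_form.
do 4!(rewrite rmorph_sum; apply: eq_bigr => ? _).
rewrite !mxE; do 4!(rewrite rmorphM; congr (_ * _)); exact: ev_wl.
Qed.

Lemma ev_cotton_form u (Uu : U u) (V1 V2 V3 : 'rV[S]_4) :
  ev S Uu (form3 (rcotton d g) V1 V2 V3) = cotton_form G u (map_mx (ev S Uu) V1)
    (map_mx (ev S Uu) V2) (map_mx (ev S Uu) V3).
Proof.
rewrite /form3 /cotton_form.
do 3!(rewrite rmorph_sum; apply: eq_bigr => ? _).
rewrite !mxE; do 3!(rewrite rmorphM; congr (_ * _)); exact: ev_cot.
Qed.

Lemma ev_dot u (Uu : U u) (V1 V2 : 'rV[S]_4) :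
  ev S Uu (rdot g V1 V2) = gdot (G u) (map_mx (ev S Uu) V1)
    (map_mx (ev S Uu) V2).
Proof.
rewrite /gdot -form2_mx /rdot /form2.
do 2!(rewrite rmorph_sum; apply: eq_bigr => ? _).
by rewrite !rmorphM ev_gmx !mxE.
Qed.

Lemma ev_lie u (Uu : U u) (V1 V2 : 'rV[S]_4) (X Y : V -> 'rV[C]_4) :
  (forall v (Uv : U v) a, ev S Uv (V1 0 a) = X v 0 a) ->
  (forall v (Uv : U v) a, ev S Uv (V2 0 a) = Y v 0 a) ->
  map_mx (ev S Uu) (lie d V1 V2) = lie_bracket X Y u.
Proof.
move=> EX EY; apply/rowP => a; rewrite !mxE /along rmorphB !rmorph_sum -sumrB.
apply: eq_bigr => b _; rewrite !rmorphM.
have -> : ev S Uu (d b (V2 0 a)) = cpartial b (fun v => Y v 0 a) u.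
  by apply: ev_deriv => v Uv; apply: EY.
have -> : ev S Uu (d b (V1 0 a)) = cpartial b (fun v => X v 0 a) u.
  by apply: ev_deriv => v Uv; apply: EX.
by rewrite EX EY.
Qed.

Lemma weyl_is_weyl_tensor u : U u ->
  is_weyl_tensor (invmx (G u)) (fun a b c e => weyl G a b c e u).
Proof.
move=> Uu; have [h1 h2 h3 h4] := wl_weyl_tensor d g.
split=> [a b c e|a b c e|a b c e|b e]; rewrite -?(ev_wl Uu).
- by rewrite h1 rmorphN.
- by rewrite h2.
- by rewrite -!rmorphD h3 rmorph0.
- rewrite -[RHS](rmorph0 (ev S Uu)) -(h4 b e) rmorph_sum.
  apply: eq_bigr => a _; rewrite rmorph_sum; apply: eq_bigr => c _.
  by rewrite rmorphM ev_wl ev_ginv.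
Qed.

End EvaluateCurvature.

(** * Petrov types at a point *)

Section Integrability.
Variables (A : comPzRingType) (d : commuting_derivations A 4) (g :
  ring_metric A 4).
Variables m p n k : 'rV[A]_4.
Hypothesis fr : is_null_frame (gmx g) m p n k.
Local Notation nab := (nabla d g).
Local Notation dot := (form2 (gmx g)).
Local Notation Omega := (omega d g m k).

(** A totally null plane of rank two is its own orthogonal, so these two products measure the
    failure of the bracket to lie in [N]. *)
Lemma omega_lie : dot (lie d m k) m = - Omega m /\ dot (lie d m k) k = - Omega
  k.
Proof.
rewrite !(lie_dot d g) !(connE d fr) /omega.
by split; ring.
Qed.

(** Sections of [N] are the fields orthogonal to [m] and [k]. When [omega] vanishes on [N],
    covariant derivatives along [N] preserve [N], and so does the bracket, being their
    difference. *)
Lemma lie_integrable x y : Omega m = 0 -> Omega k = 0 ->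
  dot x m = 0 -> dot x k = 0 -> dot y m = 0 -> dot y k = 0 ->
  dot (lie d x y) m = 0 /\ dot (lie d x y) k = 0.
Proof.
move=> om ok xm xk ym yk; rewrite !(lie_dot d g).
have H V W : dot V m = 0 -> dot V k = 0 -> dot W m = 0 -> dot W k = 0 ->
    dot (nab V W) m = 0 /\ dot (nab V W) k = 0.
  move=> Vm Vk Wm Wk.
  have oV : dot (nab V m) k = 0.
    rewrite (nabla_frame d fr) -[dot (nab m m) k]/(Omega m).
    by rewrite -[dot (nab k m) k]/(Omega k) om ok Vm Vk; ring.
  have N e : dot W e = 0 -> dot (nab V W) e = - dot (nab V e) W.
    by move=> We; apply: (@along_const _ d g V e W 0);
      rewrite (form2_sym (gmx_sym g)).
  rewrite (N _ Wm) (N _ Wk) !(null_frame_dot (gmx_sym g) (gmxV g) fr _ W) Wm Wk.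
  by rewrite !(connE d fr) oV; split; ring.
have [-> ->] := H x y xm xk ym yk; have [-> ->] := H y x ym yk xm xk.
by rewrite subrr.
Qed.

End Integrability.

Section Polynomials.
Variable F : fieldType.
Implicit Types (q : {poly F}) (z : F).

Lemma double_root q z : ('X - z%:P) ^+ 2 %| q -> q.[z] = 0 /\ q^`().[z] = 0.
Proof.
move=> /dvdpP[r ->]; rewrite expr2 !derivM derivXsubC !hornerE subrr /=.
by split; ring.
Qed.

End Polynomials.

Section Petrov.
Variables (R : realType) (G : 'rV[R]_4 -> 'M[R[i]]_4) (u : 'rV[R]_4) (w : R[i]).
Local Notation C := R[i].
Local Notation W := (weyl_form G u).
Hypothesis Gsym : (G u)^T = G u.
Hypothesis Gunit : G u \in unitmx.
Hypothesis TW : is_weyl_tensor (invmx (G u)) (fun a b c e => weyl G a b c e u).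

Let GiG : invmx (G u) *m G u = 1%:M. Proof. exact: mulVmx. Qed.
Let h2 : 2%:R * 2^-1 = 1 :> C. Proof. by rewrite mulfV // pnatr_eq0. Qed.

Lemma gdotE v1 v2 : gdot (G u) v1 v2 = form2 (G u) v1 v2.
Proof. by rewrite form2_mx. Qed.

Lemma null_frameP m p n k :
  null_frame (G u) m p n k <-> is_null_frame (G u) m p n k.
Proof.
split=> [[mp nk [mm pp nn kk] [mn mk pn pk]]|[mp nk mm pp nn kk mn mk pn pk]].
  by split; rewrite -gdotE.
by split=> //; [rewrite gdotE|rewrite gdotE|split; rewrite gdotE|split;
  rewrite gdotE].
Qed.

Lemma span2P (m k v : 'rV[C]_4) :
  reflect (exists a b, v = a *: m + b *: k) (v \in <<[:: m; k]>>%VS).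
Proof.
rewrite span_cons span_seq1; apply: (iffP memv_addP).
  move=> [_ /vlineP[a ->] [_ /vlineP[b ->] ->]]; by exists a, b.
move=> [a [b ->]]; exists (a *: m); first by rewrite memvZ ?memv_line.
by exists (b *: k); rewrite ?memvZ ?memv_line.
Qed.

Lemma weyl_form_expansion m p n k V1 V2 V3 V4 : is_null_frame (G u) m p n k ->
  W V1 V2 V3 V4 = weyl_expansion (G u) W m p n k V1 V2 V3 V4.
Proof. by move=> fr; apply: (weyl_frame h2 TW Gsym GiG fr). Qed.

Lemma weyl_form_antisym34 V1 V2 V3 V4 : W V1 V2 V4 V3 = - W V1 V2 V3 V4.
Proof. exact: (weylF_antisym34 TW). Qed.

(* The condition on the plane spanned by [m] and [k] in a form that does not
   mention the rest of the frame. *)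
Lemma weyl_form_plane m p n k : is_null_frame (G u) m p n k ->
  W m k m k = 0 -> W m k n k = 0 ->
  forall Z1 Z2 Z3 Z4, Z1 \in <<[:: m; k]>>%VS -> Z2 \in <<[:: m; k]>>%VS ->
    Z3 \in <<[:: m; k]>>%VS -> W Z1 Z2 Z3 Z4 = 0.
Proof.
move=> fr P0 P1 Z1 Z2 Z3 Z4 N1 N2 N3.
have Z Z' : Z' \in <<[:: m;
  k]>>%VS -> form2 (G u) Z' m = 0 /\ form2 (G u) Z' k = 0.
  move=> /span2P[a [b ->]]; rewrite !(form2D1, form2Z1) !(null_dotE Gsym fr).
  by split; ring.
have [Z1m Z1k] := Z _ N1; have [Z2m Z2k] := Z _ N2; have [Z3m Z3k] := Z _ N3.
rewrite (weyl_form_expansion _ _ _ _ fr) /weyl_expansion; cbv zeta beta.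
by rewrite P0 P1 Z1m Z1k Z2m Z2k Z3m Z3k; ring.
Qed.

(** The null rotation that makes the plane of parameter [z] the span of the first and last frame
    vectors; [frame_swap] does this for the parameter at infinity. *)
Lemma frame_transvection m p n k z : is_null_frame (G u) m p n k ->
  is_null_frame (G u) (m + z *: n) p n (k - z *: p).
Proof.
move=> fr; have E := null_dotE Gsym fr.
have N1 (v v' : 'rV[C]_4) : form2 (G u) (- v) v' = - form2 (G u) v v'.
  by rewrite -scaleN1r form2Z1 mulN1r.
have N2 (v v' : 'rV[C]_4) : form2 (G u) v (- v') = - form2 (G u) v v'.
  by rewrite -scaleN1r form2Z2 mulN1r.
by split; rewrite ?(form2D1, form2D2, form2Z1, form2Z2, N1, N2) ?E; ring.
Qed.

Lemma frame_swap m p n k : is_null_frame (G u) m p n k ->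
  is_null_frame (G u) n k m p.
Proof. by move=> fr; have E := null_dotE Gsym fr; split; rewrite E. Qed.

(** In the rotated frame, [Psi0] is the value of the quartic at [z] and [4 * Psi1] its derivative
    there, so a multiple root makes both vanish. *)
Lemma multiple_principal_weyl V : multiple_principal_plane G u w V ->
  forall Z1 Z2 Z3 Z4, Z1 \in V -> Z2 \in V -> Z3 \in V -> W Z1 Z2 Z3 Z4 = 0.
Proof.
move=> [m [p [n [k [z [[/null_frameP fr _] -> mz]]]]]].
have E := null_dotE Gsym fr; case: z mz => [z|] mz /=; last first.
  (* At infinity, multiplicity two means formal degree four drops to at most two; the two vanishing
     coefficients are [Psi4] and [- 4 * Psi3]. *)
  have c i : (3 <= i)%N -> (petrov_quartic G u m p n k)`_i = 0.
    move=> i3; apply: nth_default; apply: leq_trans i3.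
    by move: mz => /=; rewrite addnC; apply.
  have := c 4 isT; have := c 3 isT; rewrite /petrov_quartic.
  rewrite !(coefD, coefN, coefZ, coefXn, coefX, coefC) /= => c3 c4.
  have P4 : W p n p n = 0 by move: c4; rewrite /Psi4 => <-; ring.
  have P3 : W p n m p = 0.
    by apply: (mulfI (_ : -4%:R != 0 :> C));
      rewrite ?oppr_eq0 ?pnatr_eq0 // mulr0
      -c3 /Psi3; ring.
  apply: (weyl_form_plane (frame_swap fr)).
    rewrite (weyl_form_expansion _ _ _ _ fr) /weyl_expansion; cbv zeta beta.
    by rewrite P4 !E; ring.
  rewrite (weyl_form_expansion _ _ _ _ fr) /weyl_expansion; cbv zeta beta.
  by rewrite P4 P3 !E; ring.
have [q0 q1] := double_root mz.
have fr' := frame_transvection z fr.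
have N1 (v v' : 'rV[C]_4) : form2 (G u) (- v) v' = - form2 (G u) v v'.
  by rewrite -scaleN1r form2Z1 mulN1r.
apply: (weyl_form_plane fr').
  rewrite -[RHS]q0 /petrov_quartic !hornerE /= /Psi0 /Psi1 /Psi2 /Psi3 /Psi4.
  rewrite [LHS](weyl_form_expansion _ _ _ _ fr) /weyl_expansion; cbv zeta beta.
  rewrite !(form2D1, form2Z1, N1) !E; ring.
apply: (mulfI (_ : 4%:R != 0 :> C)); rewrite ?pnatr_eq0 // mulr0.
rewrite -[RHS]q1 /petrov_quartic !(derivD, derivN, derivZ, derivXn, derivX,
  derivC).
rewrite !hornerE /= /Psi0 /Psi1 /Psi2 /Psi3 /Psi4.
rewrite [X in _ * X = _](weyl_form_expansion _ _ _ _ fr) /weyl_expansion.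
cbv zeta beta; rewrite !(form2D1, form2Z1, N1) !E.
by ring.
Qed.

Lemma multiple_principal_span m p n k : sd_null_frame (G u) w m p n k ->
  W m k m k = 0 -> W m k n k = 0 ->
  multiple_principal_plane G u w <<[:: m; k]>>%VS.
Proof.
move=> fr P0 P1; exists m, p, n, k, (Some 0); split=> //=.
  by rewrite !scale0r subr0 addr0.
rewrite subr0 /petrov_quartic /Psi0 /Psi1 P0 P1 mulr0 scale0r !addr0.
apply/dvdpP; exists (Psi4 G u m p n k *: 'X^2 - (4 * Psi3 G u m p n k) *: 'X
  + (6 * Psi2 G u m p n k)%:P).
rewrite -!mul_polyC; ring.
Qed.

(** The quartic is divisible by the cube of the variable, so [Psi3] and [Psi4] decide the type. Used
    in the contrapositive: away from these types [Psi2] is nonzero. *)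
Lemma petrov_special m p n k : sd_null_frame (G u) w m p n k ->
  W m k m k = 0 -> W m k n k = 0 -> W m k p n = 0 ->
  [\/ petrov_III G u w, petrov_N G u w | petrov_0 G u w].
Proof.
move=> fr P0 P1 P2.
have qE : petrov_quartic G u m p n k =
    (Psi4 G u m p n k *: 'X - (4 * Psi3 G u m p n k)%:P) * 'X^3.
  rewrite /petrov_quartic /Psi0 /Psi1 /Psi2 P0 P1 P2 !mulr0 !scale0r !addr0.
  by rewrite -!mul_polyC; ring.
have [P3|P3] := eqVneq (Psi3 G u m p n k) 0; last first.
  constructor 1; exists m, p, n, k, (Some 0); split=> //=; rewrite subr0 qE.
    exact: dvdp_mulIr.
  apply/negP => /dvdpP[r] /(congr1 (fun q : {poly C} => q`_3)).
  rewrite coefMXn /= coefMXn /= !(coefB, coefZ, coefX, coefC) /= => /eqP.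
  by rewrite mulr0 sub0r oppr_eq0 mulf_eq0 pnatr_eq0 (negPf P3).
have [P4|P4] := eqVneq (Psi4 G u m p n k) 0.
  by constructor 3; exists m, p, n, k; split.
have qE' : petrov_quartic G u m p n k = Psi4 G u m p n k *: 'X^4.
  by rewrite qE P3 mulr0 -!mul_polyC; ring.
constructor 2; exists m, p, n, k, (Some 0); split=> //=; rewrite qE'.
  by rewrite scaler_eq0 (negPf P4) -size_poly_eq0 size_polyXn.
by rewrite subr0 dvdpZr.
Qed.

(** Antisymmetry in the last two slots leaves only the pair [m], [k] there, hence two components on
    a plane. *)
Lemma cotton_form_plane (m k : 'rV[C]_4) :
  cotton_form G u m m k = 0 -> cotton_form G u k m k = 0 ->
  forall Z1 Z2 Z3, Z1 \in <<[:: m; k]>>%VS -> Z2 \in <<[:: m; k]>>%VS ->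
    Z3 \in <<[:: m; k]>>%VS -> cotton_form G u Z1 Z2 Z3 = 0.
Proof.
pose T a b c := cotton G a b c u.
have anti V X Y : form3 T V Y X = - form3 T V X Y.
  rewrite /form3 -sumrN; apply: eq_bigr => a _; rewrite exchange_big /= -sumrN.
  apply: eq_bigr => b _; rewrite -sumrN; apply: eq_bigr => c _.
  by rewrite /T /cotton; ring.
have diag V X : form3 T V X X = 0.
  by apply: (double_eq0 h2); rewrite {1}anti addNr.
move=> Hm Hk Z1 Z2 Z3 /span2P[a1 [b1 ->]] /span2P[a2 [b2 ->]] /span2P[a3 [b3
  ->]].
change (form3 T m m k = 0) in Hm; change (form3 T k m k = 0) in Hk.
change (form3 T (a1 *: m + b1 *: k) (a2 *: m + b2 *: k)
  (a3 *: m + b3 *: k) = 0).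
have Z3E V X c (Y : 'rV[C]_4) : form3 T V X (c *: Y) = c * form3 T V X Y.
  by apply: (lin_scale (F := form3 T V X)) => *; apply: form3_lin3.
have Z2E V X c (Y : 'rV[C]_4) : form3 T V (c *: X) Y = c * form3 T V X Y.
  by rewrite anti Z3E anti mulrN opprK.
have Z1E V X c (Y : 'rV[C]_4) : form3 T (c *: V) X Y = c * form3 T V X Y.
  by apply: (lin_scale (F := fun V => form3 T V X Y)) => *; apply: form3_lin1.
rewrite !(form3_lin1, form3_lin2, form3_lin3, Z1E, Z2E, Z3E) !diag.
by rewrite (anti m m k) (anti k m k) Hm Hk; ring.
Qed.

End Petrov.

(** * Local null frames *)

Section NullCompletion.
Variables (A : comPzRingType) (G : 'M[A]_4) (half h : A).
Hypotheses (Gsym : G^T = G) (halfE : 2%:R * half = 1).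
Local Notation dot := (form2 G).
Variables x y a b : 'rV[A]_4.
Hypotheses (xx : dot x x = 0) (xy : dot x y = 0) (yy : dot y y = 0).
Hypothesis hE : h * (dot x a * dot y b - dot x b * dot y a) = 1.

Lemma null_completion : exists p n, is_null_frame G x p n y.
Proof.
have C := form2_sym Gsym.
(* Cramer's rule for the combinations of [a] and [b] dual to [x] and [y]. *)
pose p0 := (h * dot y b) *: a + (- h * dot y a) *: b.
pose n0 := (- h * dot x b) *: a + (h * dot x a) *: b.
have xp : dot x p0 = 1 by rewrite /p0 form2D2 !form2Z2 -[RHS]hE; ring.
have yp : dot y p0 = 0 by rewrite /p0 form2D2 !form2Z2; ring.
have xn : dot x n0 = 0 by rewrite /n0 form2D2 !form2Z2; ring.
have yn : dot y n0 = 1 by rewrite /n0 form2D2 !form2Z2 -[RHS]hE; ring.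
clearbody p0 n0; have E2 (z : A) : z = 2%:R * half * z by rewrite halfE mul1r.
(* Multiples of [x] and [y] do not change the products with [x] and [y]. Half of each square makes
   the vectors null, and the mixed product is removed half by each. *)
exists (p0 + (- half * dot p0 p0) *: x + (- half * dot p0 n0) *: y).
exists (n0 + (- half * dot p0 n0) *: x + (- half * dot n0 n0) *: y).
have [px py nx ny] : [/\ dot p0 x = 1, dot p0 y = 0,
  dot n0 x = 0 & dot n0 y = 1].
  by rewrite !(C p0) !(C n0).
have yx : dot y x = 0 by rewrite C.
split; rewrite ?(form2D1, form2D2, form2Z1, form2Z2) ?(xp, yp, xn, yn, px, py,
  nx, ny, xx, xy, yx, yy) ?(C n0 p0) //.
- by ring.
- by ring.
- by rewrite {1}(E2 (dot p0 p0)); ring.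
- by rewrite {1}(E2 (dot n0 n0)); ring.
- by ring.
- by rewrite {1}(E2 (dot p0 n0)); ring.
- by ring.
Qed.

End NullCompletion.

(** The two by four matrix with rows [x], [y] times [G] has full row rank; the columns of a right
    inverse are dual to [x], [y]. *)
Lemma dual_pair (K : fieldType) (G : 'M[K]_4) (x y : 'rV[K]_4) :
  G \in unitmx -> \dim <<[:: x; y]>>%VS = 2%N ->
  exists a b, form2 G x a * form2 G y b - form2 G x b * form2 G y a = 1.
Proof.
move=> Gu d2.
have fxy : free [:: x; y] by rewrite /free d2.
pose M : 'M[K]_(2, 4) := \matrix_(i < 2) (if i == 0 then x else y).
have rf : row_free (M *m G).
  apply: inj_row_free => v /(congr1 (mulmx^~ (invmx G))).
  rewrite /= mul0mx mulmxA mulmxK // => vM.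
  have E : v 0 0 *: x + v 0 1 *: y = 0.
    rewrite -[RHS]vM; apply/rowP => j;
      rewrite !mxE !big_ord_recl big_ord0 !mxE /=.
    by rewrite addr0; congr (_ + v 0 _ * _); apply: val_inj.
  move: fxy; rewrite free_cons seq1_free span_seq1 => /andP[xN y0].
  have v0 : v 0 0 = 0.
    apply/eqP; apply: contraNT xN => v0; apply/vlineP;
      exists (- (v 0 1 / v 0 0)).
    move/eqP: E; rewrite addr_eq0 => /eqP/(congr1 ( *:%R (v 0 0)^-1)).
    by rewrite scalerA mulVf // scale1r => ->;
      rewrite scalerN scalerA scaleNr mulrC.
  have v1 : v 0 1 = 0.
    apply/eqP; move/eqP: E; rewrite v0 scale0r add0r scaler_eq0 (negPf y0).
    by rewrite orbF.
  apply/rowP => j; rewrite mxE.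
  case: j => [[|[|//]] jP]; [rewrite -[RHS]v0|rewrite -[RHS]v1];
    by congr (v 0 _); apply: val_inj.
have /row_freeP[B MB] := rf.
exists (col 0 B)^T, (col 1 B)^T.
have E i j : form2 G (row i M) (col j B)^T = (i == j)%:R.
  have <- : (M *m G *m B) i j = (i == j)%:R by rewrite MB mxE.
  rewrite form2_mx trmxK !mxE; apply: eq_bigr => l _; rewrite !mxE.
  by congr (_ * _); apply: eq_bigr => q _; rewrite !mxE.
have rx : row 0 M = x by apply/rowP => j; rewrite !mxE.
have ry : row 1 M = y by apply/rowP => j; rewrite !mxE.
by have := (E 0 0, E 0 1, E 1 0, E 1 1); rewrite rx ry => -[[[-> ->] ->] ->] /=;
  rewrite !(mulr0, subr0, mulr1).
Qed.

Section LocalFrame.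
Variable R : realType.
Local Notation V := 'rV[R]_4.
Local Notation C := R[i].

Lemma csmooth_nonzero_open (U : set V) (F : V -> C) : open U ->
  csmooth_on U F ->
  open [set v | U v /\ F v != 0].
Proof.
move=> oU [sr si].
pose N : V -> R := (fun v => complex.Re (F v)) * (fun v => complex.Re (F v))
  + (fun v => complex.Im (F v)) * (fun v => complex.Im (F v)).
have NE v : (N v != 0) = (F v != 0).
  rewrite /N !fctE; congr (~~ _); apply/eqP/eqP => [H|->];
    last by rewrite /= !mulr0 addr0.
  by apply: complex_ext => /=; nra.
have cN v : U v -> {for v, continuous N}.
  move=> Uv; apply: differentiable_continuous.
  by apply: differentiableD; apply: differentiableM; apply: smooth_diff Uv.
rewrite openE => v [Uv Fv]; rewrite /interior.
have H1 : \forall w \near v, U w by apply: open_nbhs_nbhs.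
have H2 : \forall w \near v, N w != 0.
  by have := cN v Uv; move/cvgr_neq0; apply; rewrite NE.
by apply: filterS2 H1 H2 => w Uw; rewrite NE.
Qed.

Variable G : V -> 'M[C]_4.
Variable W : set V.
Hypothesis sG : forall a b, csmooth_on W (fun u => G u a b).
Hypothesis Gsym : forall u, W u -> (G u)^T = G u.
Hypothesis Gunit : forall u, W u -> G u \in unitmx.

Record local_frame (U : set V) (S : smooth_model U) (g : ring_metric S 4)
    (X Y : V -> 'rV[C]_4) (m p n k : 'rV[S]_4) : Prop := LocalFrame {
  lf_open : open U;
  lf_sub : U `<=` W;
  lf_metric : forall u (Uu : U u) a b,
    [/\ ev S Uu (gmx g a b) = G u a b, ev S Uu (ginv g a b) = invmx (G u) a b &
        ev S Uu (twelfth g) = 12^-1];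
  lf_X : forall v (Uv : U v) a, ev S Uv (m 0 a) = X v 0 a;
  lf_Y : forall v (Uv : U v) a, ev S Uv (k 0 a) = Y v 0 a;
  lf_smooth : smooth_vector_on U X /\ smooth_vector_on U Y;
  lf_frame : is_null_frame (gmx g) m p n k
}.

(** Constant vectors [a], [b] dual to [X], [Y] at [u] still pair nondegenerately with them nearby.
    There the determinant is invertible as a smooth function, and algebraic completion yields a
    frame. *)
Lemma exists_local_frame U X Y u : open U -> U `<=` W -> U u ->
  smooth_vector_on U X -> smooth_vector_on U Y ->
  (forall v, U v -> [/\ gdot (G v) (X v) (X v) = 0, gdot (G v) (X v) (Y v) = 0 &
                        gdot (G v) (Y v) (Y v) = 0]) ->
  \dim <<[:: X u; Y u]>>%VS = 2%N ->
  exists U' (S : smooth_model U') (g : ring_metric S 4) m p n k,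
    [/\ U' u, U' `<=` U & local_frame g X Y m p n k].
Proof.
move=> oU UW Uu sX sY null dimXY.
have data (U1 : set V) : open U1 -> U1 `<=` U -> exists (S : smooth_model U1)
    (g : ring_metric S 4), forall u (Uu : U1 u) a b,
    [/\ ev S Uu (gmx g a b) = G u a b, ev S Uu (ginv g a b) = invmx (G u) a b &
        ev S Uu (twelfth g) = 12^-1].
  move=> oU1 U1U; have [S] := exists_smooth_model oU1.
  have U1W : U1 `<=` W by move=> v /U1U/UW.
  have [g gE] := exists_metric S oU1
    (fun a b => csmooth_sub U1W (sG a b))
    (fun v U1v => Gsym (U1W v U1v)) (fun v U1v => Gunit (U1W v U1v)).
  by exists S, g.
have row_lift (U1 : set V) (S : smooth_model U1) Z : U1 `<=` U ->
    smooth_vector_on U Z -> exists z : 'rV[S]_4,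
    forall v (Uv : U1 v), map_mx (ev S Uv) z = Z v.
  move=> U1U sZ.
  exists (\row_a lift S (csmooth_sub U1U (sZ a))) => v Uv.
  by apply/rowP => a; rewrite !mxE liftE.
have [a [b ab]] := dual_pair (Gunit (UW _ Uu)) dimXY.
have scst c : smooth_vector_on U (cst c : V -> 'rV[C]_4).
  by move=> i; apply: csmooth_cst.
pose F v := form2 (G v) (X v) a * form2 (G v) (Y v) b
  - form2 (G v) (X v) b * form2 (G v) (Y v) a.
have evF (U1 : set V) (S : smooth_model U1) (g : ring_metric S 4)
  (gE : forall u (Uu : U1 u) a b,
    [/\ ev S Uu (gmx g a b) = G u a b, ev S Uu (ginv g a b) = invmx (G u) a b &
        ev S Uu (twelfth g) = 12^-1]) (x y a' b' : 'rV[S]_4) v (Uv : U1 v) :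
    map_mx (ev S Uv) x = X v -> map_mx (ev S Uv) y = Y v ->
    map_mx (ev S Uv) a' = a -> map_mx (ev S Uv) b' = b ->
    ev S Uv (rdot g x a' * rdot g y b' - rdot g x b' * rdot g y a') = F v.
  by move=> Ex Ey Ea Eb;
    rewrite rmorphB !rmorphM !(ev_dot gE) Ex Ey Ea Eb !gdotE.
(* This first model on [U] serves to show that the determinant [F] is smooth, hence that [U'] is
   open; the frame itself lives over a model on [U']. *)
have [S0 [g0 g0E]] := data U oU (fun _ => id).
have [x0 x0E] := row_lift U S0 X (fun _ => id) sX.
have [y0 y0E] := row_lift U S0 Y (fun _ => id) sY.
have [a0 a0E] := row_lift U S0 _ (fun _ => id) (scst a).
have [b0 b0E] := row_lift U S0 _ (fun _ => id) (scst b).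
have [F' sF' F'E] := ev_smooth (rdot g0 x0 a0 * rdot g0 y0 b0 - rdot g0 x0 b0
  * rdot g0 y0 a0).
have FF' v : U v -> F' v = F v.
  by move=> Uv; rewrite -(F'E _ Uv); apply: evF.
pose U' := [set v | U v /\ F' v != 0].
have oU' : open U' by apply: csmooth_nonzero_open.
have U'U : U' `<=` U by move=> v [].
have U'u : U' u by split; rewrite // FF' // /F ab oner_neq0.
have [S [g gE]] := data U' oU' U'U.
have [x xE] := row_lift U' S X U'U sX.
have [y yE] := row_lift U' S Y U'U sY.
have [a' a'E] := row_lift U' S _ U'U (scst a).
have [b' b'E] := row_lift U' S _ U'U (scst b).
have [h hE] : exists h,
  h * (rdot g x a' * rdot g y b' - rdot g x b' * rdot g y a') = 1.
  apply: (ev_unit oU') => v U'v; rewrite (evF _ _ _ gE) //.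
  by case: (U'v) => Uv; rewrite FF'.
have nullS (z z' : 'rV[S]_4) :
    (forall v (Uv : U' v), gdot (G v) (map_mx (ev S Uv) z)
      (map_mx (ev S Uv) z') = 0) ->
    rdot g z z' = 0.
  by move=> zz; apply: (ev_inj (s := S)) => v Uv;
    rewrite (ev_dot gE) zz rmorph0.
have [p [n fr]] : exists p n, is_null_frame (gmx g) x p n y.
  apply: (null_completion (gmx_sym g) (halfE g) _ _ _ hE).
  - by apply: nullS => v Uv; rewrite xE; case: (null v (U'U _ Uv)).
  - by apply: nullS => v Uv; rewrite xE yE; case: (null v (U'U _ Uv)).
  - by apply: nullS => v Uv; rewrite yE; case: (null v (U'U _ Uv)).
exists U', S, g, x, p, n, y; split=> //; split=> //.
- by move=> v /U'U/UW.
- by move=> v Uv c; rewrite -(xE v Uv) mxE.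
- by move=> v Uv c; rewrite -(yE v Uv) mxE.
- by split=> c; apply: csmooth_sub U'U _.
Qed.

End LocalFrame.

(** * Translation between frame identities and pointwise conditions *)

Section FrameConsequences.
Variables (R : realType) (G : 'rV[R]_4 -> 'M[R[i]]_4) (W U : set 'rV[R]_4).
Local Notation V := 'rV[R]_4.
Local Notation C := R[i].
Hypothesis Gsym : forall u, W u -> (G u)^T = G u.
Hypothesis Gunit : forall u, W u -> G u \in unitmx.
Variables (S : smooth_model U) (g : ring_metric S 4) (X Y : V -> 'rV[C]_4).
Variables m p n k : 'rV[S]_4.
Hypothesis lf : local_frame G W g X Y m p n k.
Local Notation d := (sm_deriv S).
Local Notation e Uv := (map_mx (ev S Uv)).
Local Notation dot := (form2 (gmx g)).
Local Notation omega := (omega d g m k).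
Local Notation F := (form4 (rweyl d g)).
Local Notation C3 := (form3 (rcotton d g)).

Let gE := lf_metric lf.
Let fr := lf_frame lf.

Lemma frame_m v (Uv : U v) : e Uv m = X v.
Proof. by apply/rowP => a; rewrite mxE (lf_X lf). Qed.

Lemma frame_k v (Uv : U v) : e Uv k = Y v.
Proof. by apply/rowP => a; rewrite mxE (lf_Y lf). Qed.

Lemma ev_form2 v (Uv : U v) (V1 V2 : 'rV[S]_4) :
  ev S Uv (dot V1 V2) = form2 (G v) (e Uv V1) (e Uv V2).
Proof. by rewrite -gdotE -(ev_dot gE). Qed.

Lemma frame_at v (Uv : U v) :
  is_null_frame (G v) (X v) (e Uv p) (e Uv n) (Y v).
Proof.
rewrite -frame_m -frame_k; split; rewrite -ev_form2 (null_dotE (gmx_sym g) fr);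
  by rewrite ?rmorph1 ?rmorph0.
Qed.

Lemma frame_plane_dot v (Uv : U v) z : z \in <<[:: X v; Y v]>>%VS ->
  form2 (G v) z (X v) = 0 /\ form2 (G v) z (Y v) = 0.
Proof.
move=> /span2P[a [b ->]]; rewrite !(form2D1, form2Z1).
have E := null_dotE (Gsym (lf_sub lf Uv)) (frame_at Uv).
by rewrite !E; split; ring.
Qed.

Lemma frame_dot_plane v (Uv : U v) z : form2 (G v) z (X v) = 0 ->
  form2 (G v) z (Y v) = 0 -> z \in <<[:: X v; Y v]>>%VS.
Proof.
move=> zX zY; apply/span2P.
exists (form2 (G v) z (e Uv p)), (form2 (G v) z (e Uv n)).
rewrite {1}(null_frame_decomp (Gsym (lf_sub lf Uv))
  (mulVmx (Gunit (lf_sub lf Uv))) (frame_at Uv) z).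
by rewrite zX zY !scale0r !addr0.
Qed.

Lemma omega_integrable :
  (forall v, U v -> lie_bracket X Y v \in <<[:: X v; Y v]>>%VS) ->
  omega m = 0 /\ omega k = 0.
Proof.
move=> int.
have H v (Uv : U v) : e Uv (lie d m k) = lie_bracket X Y v.
  by apply: ev_lie => [w Uw a|w Uw a]; [apply: (lf_X lf)|apply: (lf_Y lf)].
have L : dot (lie d m k) m = 0 /\ dot (lie d m k) k = 0.
  split; apply: (ev_inj (s := S)) => v Uv; rewrite ev_form2 H rmorph0;
    rewrite ?frame_m ?frame_k; by case: (frame_plane_dot Uv (int v Uv)).
have [Om Ok] := omega_lie d fr; case: L; rewrite Om Ok => /eqP + /eqP.
by rewrite !oppr_eq0 => /eqP -> /eqP ->.
Qed.

Lemma integrable_omega (X0 Y0 : V -> 'rV[C]_4) : omega m = 0 -> omega k = 0 ->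
  smooth_vector_on U X0 -> smooth_vector_on U Y0 ->
  (forall v, U v -> X0 v \in <<[:: X v; Y v]>>%VS /\
                    Y0 v \in <<[:: X v; Y v]>>%VS) ->
  forall v, U v -> lie_bracket X0 Y0 v \in <<[:: X v; Y v]>>%VS.
Proof.
move=> om ok sX0 sY0 XY v Uv.
pose x : 'rV[S]_4 := \row_a lift S (sX0 a).
pose y : 'rV[S]_4 := \row_a lift S (sY0 a).
have xE w (Uw : U w) : e Uw x = X0 w by apply/rowP => a; rewrite !mxE liftE.
have yE w (Uw : U w) : e Uw y = Y0 w by apply/rowP => a; rewrite !mxE liftE.
have Z (z : 'rV[S]_4) Z0 : (forall w (Uw : U w), e Uw z = Z0 w) ->
    (forall w, U w -> Z0 w \in <<[:: X w; Y w]>>%VS) ->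
    dot z m = 0 /\ dot z k = 0.
  move=> zE ZN; split; apply: (ev_inj (s := S)) => w Uw;
    rewrite ev_form2 zE rmorph0 ?frame_m ?frame_k;
    by case: (frame_plane_dot Uw (ZN w Uw)).
have [xm xk] := Z x X0 xE (fun w Uw => proj1 (XY w Uw)).
have [ym yk] := Z y Y0 yE (fun w Uw => proj2 (XY w Uw)).
have [lm lk] := lie_integrable fr om ok xm xk ym yk.
have <- : e Uv (lie d x y) = lie_bracket X0 Y0 v.
  by apply: ev_lie => w Uw a; rewrite mxE; apply: liftE.
apply: (frame_dot_plane Uv); rewrite -?(frame_m Uv) -?(frame_k Uv) -ev_form2.
  by rewrite lm rmorph0.
by rewrite lk rmorph0.
Qed.

Lemma cotton_frame : (forall v, U v -> forall Z1 Z2 Z3,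
    Z1 \in <<[:: X v; Y v]>>%VS -> Z2 \in <<[:: X v; Y v]>>%VS ->
    Z3 \in <<[:: X v; Y v]>>%VS -> cotton_form G v Z1 Z2 Z3 = 0) ->
  C3 m m k = 0 /\ C3 k m k = 0.
Proof.
move=> cot0; split; apply: (ev_inj (s := S)) => v Uv;
  rewrite (ev_cotton_form gE) rmorph0 frame_m frame_k;
  apply: cot0 => //; apply/span2P;
  solve [by exists 1, 0; rewrite scale1r scale0r addr0
        |by exists 0, 1; rewrite scale1r scale0r add0r].
Qed.

Lemma ev_weyl v (Uv : U v) V1 V2 V3 V4 : ev S Uv (F V1 V2 V3 V4) =
  weyl_form G v (e Uv V1) (e Uv V2) (e Uv V3) (e Uv V4).
Proof. exact: (ev_weyl_form gE). Qed.

Lemma weyl_tensor_at v : U v ->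
  is_weyl_tensor (invmx (G v)) (fun a b c e => weyl G a b c e v).
Proof. exact: (weyl_is_weyl_tensor gE). Qed.

Lemma special_integrable : omega m = 0 -> omega k = 0 ->
  C3 m m k = 0 -> C3 k m k = 0 -> forall v (Uv : U v),
  weyl_form G v (X v) (Y v) (X v) (Y v) = 0 /\
  weyl_form G v (X v) (Y v) (e Uv n) (Y v) = 0.
Proof.
move=> om ok Am Ak v Uv.
have P0 := Psi0_integrable fr om ok;
  have P1 := Psi1_sqr_integrable fr om ok Am Ak.
split; rewrite -!(frame_m Uv) -!(frame_k Uv) -ev_weyl;
  first by rewrite P0 rmorph0.
move/(congr1 (ev S Uv)): P1;
  rewrite rmorphM rmorphXn rmorph_nat rmorph0 => /eqP.
by rewrite mulf_eq0 pnatr_eq0 /= sqrf_eq0 => /eqP.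
Qed.

Section Special.
Hypothesis sp : forall v (Uv : U v),
  weyl_form G v (X v) (Y v) (X v) (Y v) = 0 /\
  weyl_form G v (X v) (Y v) (e Uv n) (Y v) = 0.

Lemma special_Psi : F m k m k = 0 /\ F m k n k = 0.
Proof.
by split; apply: (ev_inj (s := S)) => v Uv;
  rewrite ev_weyl rmorph0 frame_m frame_k; case: (sp Uv).
Qed.

Lemma special_cotton_omega :
  3%:R * omega m * F m k p n + C3 m m k = 0 /\
  3%:R * omega k * F m k p n + C3 k m k = 0.
Proof.
have [P0 P1] := special_Psi.
have Bm := bianchi_m fr P0; have Bk := bianchi_k fr P0.
by rewrite P1 along0 mulr0 add0r in Bm; rewrite P1 along0 mulr0 add0r in Bk.
Qed.

(** The ring is not a domain, so the product with [Psi2] cannot be cancelled. Instead, a nonzero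
    value of [omega] would persist on an open set, which contains a point where [Psi2] is nonzero as
    well. *)
Lemma special_omega : C3 m m k = 0 -> C3 k m k = 0 ->
  (forall U1 : set V, open U1 -> U1 `<=` U -> U1 !=set0 ->
     exists v (Uv : U v), U1 v /\
       weyl_form G v (X v) (Y v) (e Uv p) (e Uv n) != 0) ->
  omega m = 0 /\ omega k = 0.
Proof.
move=> Am Ak dense; have [Em Ek] := special_cotton_omega.
rewrite Am addr0 in Em; rewrite Ak addr0 in Ek.
have H f : 3%:R * f * F m k p n = 0 -> f = 0.
  move=> f0; apply: (ev_inj (s := S)) => v Uv; rewrite rmorph0.
  apply: contrapT => /eqP fv.
  have [f' sf' ff'] := ev_smooth f.
  have oU1 := csmooth_nonzero_open (lf_open lf) sf'.
  have [||w [Uw [[_ fw] Pw]]] := dense _ oU1.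
  - by move=> w [].
  - by exists v; split; rewrite // -(ff' _ Uv).
  move/(congr1 (ev S Uw)): f0; rewrite !rmorphM rmorph_nat rmorph0 ev_weyl.
  rewrite frame_m frame_k ff' => /eqP.
  by rewrite !mulf_eq0 pnatr_eq0 (negPf fw) (negPf Pw).
by split; apply: H.
Qed.

End Special.

End FrameConsequences.

(** * The theorem on the manifold *)

Section Main.
Variables (R : realType) (M : topologicalType) (A : smooth_atlas R M).
Variables (g : complex_metric A) (o : orientation g) (N : plane_field A).
Hypothesis N_sd_null : sd_null_field o N.

(** The set [W] is a parameter because involutivity concerns sections given on an arbitrary open
    subset of the chart; otherwise it is the whole chart image. *)
Lemma field_local_frame i (W : set 'rV[R]_4) u : open W ->
  W `<=` chart_img (A i) -> W u ->
  exists (U : set 'rV[R]_4) (S : smooth_model U) (gS :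
    ring_metric S 4) X Y m p n k,
    [/\ U u, local_frame (g i) W gS X Y m p n k &
        forall v, U v -> N i v = <<[:: X v; Y v]>>%VS].
Proof.
move=> oW Wi Wu.
have [U0 [X [Y [[oU0 U0u U0i] sX sY NE]]]] := plane_smooth N (Wi _ Wu).
pose U1 := U0 `&` W.
have oU1 : open U1 by apply: openI.
have U10 : U1 `<=` U0 by move=> v [].
have U1W : U1 `<=` W by move=> v [].
have mem v : U0 v -> X v \in N i v /\ Y v \in N i v.
  move=> Uv; rewrite NE //; split; apply/span2P.
    by exists 1, 0; rewrite scale1r scale0r addr0.
  by exists 0, 1; rewrite scale1r scale0r add0r.
have sG a b : csmooth_on W (fun v => g i v a b).
  by apply: (csmooth_sub Wi); apply: metric_smooth.
have [||v [Uv Wv]||U [S [gS [m [p [n [k [Uu UU1 lf]]]]]]]] :=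
  @exists_local_frame R (g i) W sG (fun v Wv => Defs.metric_sym g (Wi v Wv))
    (fun v Wv => metric_nondeg g (Wi v Wv)) U1 X Y u oU1 U1W (conj U0u Wu).
- by move=> a; apply: csmooth_sub U10 (sX a).
- by move=> a; apply: csmooth_sub U10 (sY a).
- have [T _] := N_sd_null (Wi _ Wv); have [MX MY] := mem _ Uv.
  by split; apply: T.
- by rewrite -NE // plane_dim //; apply: Wi.
exists U, S, gS, X, Y, m, p, n, k; split=> // v Uv.
by apply: NE; apply: U10; apply: UU1.
Qed.

(** Otherwise [K] would contain the preimage of [U1] in the chart domain, which is a neighbourhood
    of a point. *)
Lemma exists_generic_point i (K : set M) (U1 : set 'rV[R]_4) :
  interior K = set0 -> type_III_N_0_set o `<=` K ->
  open U1 -> U1 `<=` chart_img (A i) -> U1 !=set0 ->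
  exists v, U1 v /\ ~ [\/ petrov_III (g i) v (o i v),
    petrov_N (g i) v (o i v) | petrov_0 (g i) v (o i v)].
Proof.
move=> K0 TK oU1 U1i [u U1u]; apply: contrapT => H.
have [x dx xu] := U1i _ U1u.
suff : interior K x by rewrite K0.
have H1 : \forall y \near x, chart_dom (A i) y.
  by apply: open_nbhs_nbhs; split=> //; apply: chart_dom_open.
have H2 : \forall y \near x, U1 (chart_map (A i) y).
  apply: (chart_map_cont dx); rewrite xu.
  exact: open_nbhs_nbhs.
apply: filterS2 H1 H2 => y dy Uy; apply: TK; exists i; split=> //=.
by apply: contrapT => T; apply: H; exists (chart_map (A i) y).
Qed.

Lemma field_sd_frame i v (P Q X Y : 'rV[R[i]]_4) : chart_img (A i) v ->
  N i v = <<[:: X; Y]>>%VS -> is_null_frame (g i v) X P Q Y ->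
  sd_null_frame (g i v) (o i v) X P Q Y.
Proof.
move=> iv NE fr; split; first exact/null_frameP.
by rewrite -NE; case: (N_sd_null iv).
Qed.

Lemma special_at i v (Q X Y : 'rV[R[i]]_4) : chart_img (A i) v ->
  is_weyl_tensor (invmx (g i v)) (fun a b c e => weyl (g i) a b c e v) ->
  multiple_principal_field o N ->
  N i v = <<[:: X; Y]>>%VS ->
  weyl_form (g i) v X Y X Y = 0 /\ weyl_form (g i) v X Y Q Y = 0.
Proof.
move=> iv TW mp NE; have [_ mpN] := mp i v iv.
have H := multiple_principal_weyl (Defs.metric_sym g iv)
  (metric_nondeg g iv) TW mpN.
have [MX MY] : X \in N i v /\ Y \in N i v.
  rewrite NE; split; apply/span2P.
    by exists 1, 0; rewrite scale1r scale0r addr0.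
  by exists 0, 1; rewrite scale1r scale0r add0r.
(* Swapping the last two slots puts the arbitrary vector [Q] last, with the first three arguments in
   the plane. *)
by split; rewrite ?(weyl_form_antisym34 TW _ _ Y Q) H ?oppr0.
Qed.

End Main.

Theorem theorem5p28 (R : realType) (M : topologicalType)
    (A : smooth_atlas R M) (M_hausdorff : hausdorff_space M)
    (M_second_countable : @second_countable M)
    (g : complex_metric A) (o : orientation g) (g_generic : II_generic o)
    (N : plane_field A) (N_sd_null : sd_null_field o N) :
  [/\ cotton_degenerate g N -> integrable_field N ->
        multiple_principal_field o N,
      cotton_degenerate g N -> multiple_principal_field o N ->
        integrable_field N &
      integrable_field N -> multiple_principal_field o N ->
        cotton_degenerate g N].
Proof.
have int_omega i U (S : smooth_model U) gS X Y m p n k : integrable_field N ->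
    local_frame (g i) (chart_img (A i)) gS X Y m p n k ->
    (forall v, U v -> N i v = <<[:: X v; Y v]>>%VS) ->
    omega (sm_deriv S) gS m k m = 0 /\ omega (sm_deriv S) gS m k k = 0.
  move=> int lf NE.
  apply: (omega_integrable (fun u iu => Defs.metric_sym g iu) lf) => v Uv.
  have [sX sY] := lf_smooth lf; rewrite -NE //.
  apply: (int i U X Y (lf_open lf) (lf_sub lf) sX sY) => // w Uw; rewrite NE //.
  split; apply/span2P.
    by exists 1, 0; rewrite scale1r scale0r addr0.
  by exists 0, 1; rewrite scale1r scale0r add0r.
have iopen i : open (chart_img (A i)) by apply: chart_img_open.
have cot_frame i W U (S : smooth_model U) gS X Y m p n k : cotton_degenerate g N ->
    W `<=` chart_img (A i) -> local_frame (g i) W gS X Y m p n k ->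
    (forall v, U v -> N i v = <<[:: X v; Y v]>>%VS) ->
    form3 (rcotton (sm_deriv S) gS) m m k = 0 /\ form3 (rcotton (sm_deriv S) gS) k m k = 0.
  move=> cot Wi lf NE; apply: (cotton_frame lf) => v Uv Z1 Z2 Z3.
  by rewrite -NE //; apply: cot; apply: Wi; apply: (lf_sub lf).
split.
(* Here [omega] and the Cotton tensor vanish on [N], so the curvature argument gives
   [Psi0 = Psi1 = 0]. *)
- move=> cot int i u iu.
  have [U [S [gS [X [Y [m [p [n [k [Uu lf NE]]]]]]]]]] :=
    field_local_frame N_sd_null (iopen i) (fun _ => id) iu.
  have [om ok] := int_omega _ _ _ _ _ _ _ _ _ _ int lf NE.
  have [Am Ak] := cot_frame _ _ _ _ _ _ _ _ _ _ _ cot (fun _ => id) lf NE.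
  have [P0 P1] := special_integrable lf om ok Am Ak Uu.
  have fr := field_sd_frame N_sd_null iu (NE u Uu)
    (frame_at lf Uu).
  have mp := multiple_principal_span fr P0 P1.
  by rewrite (NE u Uu); split=> //; exists <<[:: X u; Y u]>>%VS.
- move=> cot mp i U0 X0 Y0 oU0 U0i sX0 sY0 XY0 u U0u.
  have [U [S [gS [X [Y [m [p [n [k [Uu lf NE]]]]]]]]]] :=
    field_local_frame N_sd_null oU0 U0i U0u.
  have Ui v : U v -> chart_img (A i) v by move=> Uv; apply/U0i/(lf_sub lf).
  have Gs v (v0 : U0 v) := Defs.metric_sym g (U0i v v0).
  have Gu v (v0 : U0 v) := metric_nondeg g (U0i v v0).
  have sp v (Uv : U v) : weyl_form (g i) v (X v) (Y v) (X v) (Y v) = 0 /\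
      weyl_form (g i) v (X v) (Y v) (map_mx (ev S Uv) n) (Y v) = 0.
    apply: (special_at (map_mx (ev S Uv) n) (Ui v Uv) _ mp (NE v Uv)).
    exact: (weyl_tensor_at lf Uv).
  have [Am Ak] := cot_frame _ _ _ _ _ _ _ _ _ _ _ cot U0i lf NE.
  have [om ok] : omega (sm_deriv S) gS m k m = 0 /\ omega (sm_deriv S) gS m k k = 0.
    (* Genericity provides the dense set: with [Psi0 = Psi1 = 0], a zero of [Psi2] would force type
       III, N or 0. *)
    apply: (special_omega lf sp Am Ak) => U1 oU1 U1U U1n0.
    have [K [_ K0 TK]] := g_generic.
    have [v [U1v nT]] := exists_generic_point K0 TK oU1
      (fun w (w1 : U1 w) => Ui w (U1U w w1)) U1n0.
    have Uv := U1U v U1v; exists v, Uv; split=> //; apply/negP => /eqP P2.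
    have [P0 P1] := sp v Uv.
    have fr := field_sd_frame N_sd_null (Ui v Uv) (NE v Uv)
      (frame_at lf Uv).
    exact: nT (petrov_special fr P0 P1 P2).
  rewrite (NE u Uu); apply: (integrable_omega Gs Gu lf om ok) => //.
  + by move=> a; apply: csmooth_sub (sX0 a); apply: (lf_sub lf).
  + by move=> a; apply: csmooth_sub (sY0 a); apply: (lf_sub lf).
  + by move=> v Uv; rewrite -NE //; apply/XY0/(lf_sub lf).
- move=> int mp i u iu.
  have [U [S [gS [X [Y [m [p [n [k [Uu lf NE]]]]]]]]]] :=
    field_local_frame N_sd_null (iopen i) (fun _ => id) iu.
  have [om ok] := int_omega _ _ _ _ _ _ _ _ _ _ int lf NE.
  have sp v (Uv : U v) : weyl_form (g i) v (X v) (Y v) (X v) (Y v) = 0 /\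
      weyl_form (g i) v (X v) (Y v) (map_mx (ev S Uv) n) (Y v) = 0.
    apply: (special_at (map_mx (ev S Uv) n) (lf_sub lf Uv) _ mp (NE v Uv)).
    exact: (weyl_tensor_at lf Uv).
  (* With [Psi1] identically zero and [omega] vanishing on [N], the Bianchi components reduce to the
     Cotton components alone. *)
  have [] := special_cotton_omega lf sp.
  rewrite om ok !mulr0 !mul0r !add0r => Am Ak Z1 Z2 Z3; rewrite (NE u Uu).
  apply: cotton_form_plane; rewrite -(frame_m lf Uu) -(frame_k lf Uu).
    by rewrite -(ev_cotton_form (lf_metric lf)) Am rmorph0.
  by rewrite -(ev_cotton_form (lf_metric lf)) Ak rmorph0.
Qed.
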